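(* Let $D$ be a Jordan domain in $\mathbb C$ and let $\lambda:\partial D\to\mathbb C$ with $|\lambda(\zeta)|=1$ for all $\zeta\in\partial D$, and $\varphi:\partial D\to\mathbb R$ be functions measurable with respect to harmonic measures in $D$. Then there exists an analytic function $f:D\to\mathbb C$ such that for almost every $\zeta\in\partial D$ with respect to harmonic measures in $D$, the function $\Omega_\zeta(z)=\mathrm{Re}\,\{\overline{\lambda(\zeta)}\cdot f(z)\}$ has a unique principal asymptotic value at $\zeta$, and it equals $\varphi(\zeta)$; i.e. $\lim_{z\to\zeta}\mathrm{Re}\,\{\overline{\lambda(\zeta)} f(z)\}=\varphi(\zeta)$ in the sense of the unique principal asymptotic value.
   Context: Let $\omega:D\to\mathbb D$ be a conformal map onto the unit disk, extended (by Carathéodory's theorem) to a homeomorphism $\overline D\to\overline{\mathbb D}$. A set $\mathcal E\subseteq\partial D$ is measurable with respect to harmonic measures in $D$ if $\omega(\mathcal E)$ is Lebesgue (arc length) measurable on $\partial\mathbb D$; it has harmonic measure zero if $|\omega(\mathcal E)|=0$ (this does not depend on the choice of $\omega$); a function $\psi$ on $\partial D$ is measurable with respect to harmonic measures if $\psi\circ\omega^{-1}$ is Lebesgue measurable on $\partial\mathbb D$, and ''almost every with respect to harmonic measures'' means outside a set of harmonic measure zero. For a function $\Omega:D\to\overline{\mathbb C}$, a point $\zeta\in\partial D$ and an arc $\gamma$ in $D$ terminating at $\zeta$, the cluster set is $C(\Omega,\gamma)=\{w\in\overline{\mathbb C}: \Omega(z_n)\to w \text{ for some } z_n\in\gamma,\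 z_n\to\zeta\}$. The set of principal asymptotic values of $\Omega$ at $\zeta$ is $P(\Omega,\zeta)=\bigcap_\gamma C(\Omega,\gamma)$, the intersection over all arcs $\gamma$ in $D$ terminating at $\zeta$. ''Unique principal asymptotic value equal to $c$'' means $P(\Omega,\zeta)=\{c\}$. *)

(* Defs.v *)
From HB Require Import structures.
From mathcomp Require Import all_boot all_order all_algebra.
From mathcomp Require Import all_classical all_reals all_analysis.
From mathcomp.real_closed Require Export complex.
Export Order.TTheory GRing.Theory Num.Theory.
Export numFieldTopology.Exports numFieldNormedType.Exports.

Set Implicit Arguments.
Unset Strict Implicit.
Unset Printing Implicit Defensive.

Local Open Scope classical_set_scope.
Local Open Scope ring_scope.

(* The complex plane over a real type R, seen as a numClosedFieldType so that
   MathComp-Analysis equips it with its metric / normed (over itself) structure. *)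
Definition Cplx (R : realType) : numClosedFieldType := R[i].

Section Defs.
Variable R : realType.
Local Notation C := (Cplx R).

Definition RtoC (x : R) : C := (x%:C)%C.
Definition expi (t : R) : C := (cos t +i* sin t)%C.

Definition open_disk : set C := [set z | `|z| < 1].
Definition closed_disk : set C := [set z | `|z| <= 1].

Definition bdry (D : set C) : set C := closure D `\` interior D.

Definition jordan_curve (J : set C) : Prop :=
  exists g : R -> C,
    {within `[0, 1], continuous g} /\ g 0 = g 1 /\
    (forall s t, 0 <= s < 1 -> 0 <= t < 1 -> g s = g t -> s = t) /\
    J = g @` `[0, 1].

Definition jordan_domain (D : set C) : Prop :=
  open D /\ connected D /\ D !=set0 /\ bounded_set D /\ jordan_curve (bdry D).

Definition holomorphic_on (D : set C) (f : C -> C) : Prop :=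
  forall z, D z -> derivable f z 1.

Definition conformal_ext (D : set C) (w : C -> C) : Prop :=
  holomorphic_on D w /\
  (forall z1 z2, closure D z1 -> closure D z2 -> w z1 = w z2 -> z1 = z2) /\
  w @` D = open_disk /\
  w @` closure D = closed_disk /\
  {within closure D, continuous w} /\
  exists v : C -> C, (forall z, closure D z -> v (w z) = z) /\
                     {within closed_disk, continuous v}.

(* angles theta in [0, 2pi) with e^{i theta} in w(E), E restricted to the boundary:
   the arc-length parametrisation of w(E /\ bdry D) *)
Definition theta_set (D : set C) (w : C -> C) (E : set C) : set R :=
  [set t | 0 <= t < 2 * pi /\ exists2 z, (E `&` bdry D) z & w z = expi t].

Definition lebesgue_measurable (A : set R) : Prop :=
  exists2 B : set R, measurable B &
    (@lebesgue_measure R).-negligible ((A `\` B) `|` (B `\` A)).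

Definition harm_measurable_set (D : set C) (w : C -> C) (E : set C) : Prop :=
  lebesgue_measurable (theta_set D w E).

Definition harm_null (D : set C) (w : C -> C) (E : set C) : Prop :=
  (@lebesgue_measure R).-negligible (theta_set D w E).

(* psi o w^{-1} is Lebesgue measurable on the unit circle *)
Definition harm_measurable_rfun (D : set C) (w : C -> C) (psi : C -> R) : Prop :=
  forall B : set R, measurable B -> harm_measurable_set D w (psi @^-1` B).

Definition harm_measurable_cfun (D : set C) (w : C -> C) (psi : C -> C) : Prop :=
  harm_measurable_rfun D w (fun z => @complex.Re R (psi z)) /\
  harm_measurable_rfun D w (fun z => @complex.Im R (psi z)).

Definition arc_to (D : set C) (zeta : C) (g : R -> C) : Prop :=
  (forall t, 0 <= t < 1 -> D (g t)) /\
  {within `[0, 1[, continuous g} /\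
  (forall s t, 0 <= s < 1 -> 0 <= t < 1 -> g s = g t -> s = t) /\
  g t @[t --> 1^'-] --> zeta.

(* extended complex plane: Some c = c, None = infinity *)
Definition cluster_set (Om : C -> C) (zeta : C) (g : R -> C) : set (option C) :=
  fun o => exists u : nat -> R,
    (forall n, 0 <= u n < 1) /\ g (u n) @[n --> \oo] --> zeta /\
    match o with
    | Some c => Om (g (u n)) @[n --> \oo] --> c
    | None => forall M : R, \forall n \near \oo, RtoC M < `|Om (g (u n))|
    end.

Definition principal_asymptotic_values (D : set C) (Om : C -> C) (zeta : C)
  : set (option C) :=
  [set o | forall g, arc_to D zeta g -> cluster_set Om zeta g o].

End Defs.

(* Main.v *)
(** The conformal map reduces the statement to the unit disk, where it suffices to find a
    holomorphic [f] whose radial limit is [Psi = lam * phi] at almost every point of the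
    circle.  Indeed the radius shows that no value other than [phi] is principal.
    Conversely, by Bagemihl's ambiguous point theorem all but countably many points are such
    that the radial limit belongs to the cluster set of [f] along every arc; there
    [Re (conj lam * f)] accumulates at [Re (conj lam * lam * phi) = phi] along every arc.

    The function [f] is a limit of polynomials [F_n].  Pole pushing along the positive axis
    gives polynomials [G] with [G(0) = 1], bounded on the disk minus a thin wedge and
    tiny on its boundary arc.  They show first that polynomials approximate every measurable
    function on the circle in measure, and then that
    [F_(n+1) = F_n + (1 - G(z^N)) (q - F_n)], with [q] close to [Psi] on the circle and [N]
    huge, changes [F_n] very little on a given disk, is close to [Psi] on most of the
    circle, and stays close to [F_n] along the whole of most radii.  By Borel-Cantelli
    [F_n] converges uniformly on almost every closed radius. *)
Require Import Defs.
From HB Require Import structures.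
From mathcomp Require Import all_boot all_order all_algebra.
From mathcomp Require Import all_classical all_reals all_analysis.
From mathcomp Require Import ring lra.
Set Implicit Arguments.
Unset Strict Implicit.
Unset Printing Implicit Defensive.
Local Open Scope classical_set_scope.
Local Open Scope ring_scope.

(** * Modulus and convergence in the complex plane *)

(** Prescribing the full complex limit [lam * phi] makes the direction [lam] harmless: as
    [|lam| = 1], multiplying by its conjugate and taking real parts gives [phi]. Since [phi] need
    not be integrable, no Poisson integral can produce [f]. Polynomials in [z] are not uniformly
    dense in the continuous functions on the circle, [1 / z] being already out of reach; giving up a
    small set of angles lifts this obstruction. The normalisation [G(0) = 1] makes [1 - G] divisible
    by ['X], hence [1 - G(z^N)] divisible by ['X^N] and negligible on smaller disks. On good radii
    its bound depends on the wedge alone, not on [N] nor on the accuracy of [G]. It is thus known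
    before the tolerances are chosen, which makes the corrections summable along almost every
    radius. *)

Section Modulus.
Variable R : realType.
Local Notation C := (Cplx R).

(* The norm of [Cplx R] takes its values in [Cplx R]; [nm] is the same number in [R]. *)
Definition nm (z : C) : R := ComplexField.Normc.normc z.

Lemma normE (z : C) : `|z| = RtoC (nm z).
Proof. by []. Qed.
Lemma nmD (x y : C) : nm (x + y) <= nm x + nm y.
Proof. exact: le_normcD. Qed.
Lemma nmM (x y : C) : nm (x * y) = nm x * nm y.
Proof. exact: ComplexField.Normc.normcM. Qed.
Lemma nmN (x : C) : nm (- x) = nm x.
Proof. exact: normcN. Qed.
Lemma nm0 : nm 0 = 0.
Proof. exact: ComplexField.Normc.normc0. Qed.
Lemma nm1 : nm 1 = 1.
Proof. exact: ComplexField.Normc.normc1. Qed.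
Lemma nm_ge0 (x : C) : 0 <= nm x.
Proof. by case: x => a b; exact: sqrtr_ge0. Qed.
Lemma nm_eq0 (x : C) : (nm x == 0) = (x == 0).
Proof. 
apply/eqP/eqP => [|->]; last exact: nm0.
exact: ComplexField.Normc.eq0_normc.
Qed.
Lemma nmB (x y : C) : nm (x - y) = nm (y - x).
Proof. by rewrite -nmN opprB. Qed.
Lemma nmX (x : C) n : nm (x ^+ n) = nm x ^+ n.
Proof. by elim: n => [|n IH]; rewrite ?expr0 ?nm1// !exprS nmM IH. Qed.
Lemma nmV (x : C) : nm x^-1 = (nm x)^-1.
Proof. exact: ComplexField.Normc.normcV. Qed.
Lemma nm_triangle (y x z : C) : nm (x - z) <= nm (x - y) + nm (y - z).
Proof. by rewrite (le_trans _ (nmD _ _))// addrA subrK. Qed.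
Lemma nm_gt0 (x : C) : (0 < nm x) = (x != 0).
Proof. by rewrite lt0r nm_ge0 nm_eq0 andbT. Qed.
Lemma nm_RtoC (x : R) : nm (RtoC x) = `|x|.
Proof. by rewrite /nm /RtoC /= expr0n /= addr0 sqrtr_sqr. Qed.
Lemma RtoCD (x y : R) : RtoC (x + y) = RtoC x + RtoC y.
Proof. exact: (rmorphD (real_complex R)). Qed.
Lemma RtoCB (x y : R) : RtoC (x - y) = RtoC x - RtoC y.
Proof. exact: (rmorphB (real_complex R)). Qed.
Lemma RtoCM (x y : R) : RtoC (x * y) = RtoC x * RtoC y.
Proof. exact: (rmorphM (real_complex R)). Qed.
Lemma RtoCX (x : R) n : RtoC (x ^+ n) = RtoC x ^+ n.
Proof. exact: (rmorphXn (real_complex R)). Qed.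
Lemma nm_expi t : nm (expi t) = 1.
Proof. by rewrite /nm /expi /= cos2Dsin2 sqrtr1. Qed.
Lemma nm_sqr (z : C) : nm z ^+ 2 = complex.Re z ^+ 2 + complex.Im z ^+ 2.
Proof. by case: z => a b; rewrite sqr_sqrtr// addr_ge0 ?sqr_ge0. Qed.
Lemma Re_nm (z : C) : `|complex.Re z| <= nm z.
Proof. 
rewrite -(ler_pXn2r (n:=2)) ?nnegrE ?normr_ge0 ?nm_ge0//.
by rewrite nm_sqr real_normK ?num_real// lerDl sqr_ge0.
Qed.
Lemma Im_nm (z : C) : `|complex.Im z| <= nm z.
Proof. 
rewrite -(ler_pXn2r (n:=2)) ?nnegrE ?normr_ge0 ?nm_ge0//.
by rewrite nm_sqr real_normK ?num_real// lerDr sqr_ge0.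
Qed.
Lemma nm_ReIm (z : C) : nm z <= `|complex.Re z| + `|complex.Im z|.
Proof.
rewrite -(ler_pXn2r (n:=2)) ?nnegrE ?nm_ge0 ?addr_ge0//.
rewrite nm_sqr sqrrD !real_normK ?num_real//.
by rewrite addrAC lerDl mulrn_wge0// mulr_ge0.
Qed.
Lemma expiD s t : expi (s + t) = expi s * expi t :> C.
Proof.
rewrite /expi cosD sinD; apply/eqP; rewrite eq_complex /= eqxx /=.
by apply/eqP; rewrite addrC.
Qed.
Lemma expi0 : expi 0 = 1 :> C.
Proof. by rewrite /expi cos0 sin0. Qed.
Lemma expiX t n : expi t ^+ n = expi (t * n%:R) :> C.
Proof.
elim: n => [|n IH]; first by rewrite mulr0 expr0 expi0.
by rewrite exprSr IH -expiD -natr1 mulrDr mulr1.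
Qed.
Lemma expiN t : expi t * expi (- t) = 1 :> C.
Proof. by rewrite -expiD subrr expi0. Qed.

Lemma nm_ltP (z : C) (e : R) : (`|z| < RtoC e) = (nm z < e).
Proof. by rewrite normE ltcR. Qed.
Lemma nm_leP (z : C) (e : R) : (`|z| <= RtoC e) = (nm z <= e).
Proof. by rewrite normE lecR. Qed.

Lemma posC (e : C) : 0 < e -> exists2 d : R, 0 < d & e = RtoC d.
Proof.
case: e => a b; rewrite ltcE /= => /andP[/eqP-> a0]; exists a => //.
Qed.

Lemma cvg_nm (T : Type) (F : set_system T) (FF : Filter F) (f : T -> C) (l : C) :
  f t @[t --> F] --> l <-> forall e : R, 0 < e -> \forall t \near F, nm (f t - l) < e.
Proof.
split => [fl e e0|H].
  have e0' : 0 < RtoC e :> C by rewrite ltcR.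
  move/cvgrPdist_lt: fl => /(_ _ e0').
  by apply: filterS => t; rewrite nm_ltP nmB.
apply/cvgrPdist_lt => e /posC[d d0 ->].
by apply: filterS (H _ d0) => t; rewrite nm_ltP nmB.
Qed.

Lemma nbhs_nm (A : set C) (z : C) :
  nbhs z A <-> exists2 e : R, 0 < e & forall y, nm (y - z) < e -> A y.
Proof.
split.
  move=> /nbhs_normP[e /= /posC[d d0 ->]] H; exists d => // y yz.
  by apply: H => /=; rewrite nm_ltP nmB.
case=> e e0 H; apply/nbhs_normP; exists (RtoC e); rewrite /= ?ltcR// => y /=.
by rewrite nm_ltP nmB; exact: H.
Qed.
End Modulus.

(** * Coefficient norm of polynomials *)

Section CoefNorm.
Variable R : realType.
Local Notation C := (Cplx R).
Implicit Types (p q : {poly C}) (z h : C) (r s : R).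

Definition absp p : {poly R} := \poly_(i < size p) nm p`_i.

Lemma coef_absp p i : (absp p)`_i = nm p`_i.
Proof.
rewrite coef_poly; case: ltnP => // sp.
by rewrite nth_default// nm0.
Qed.

Lemma absp_ge0 p i : 0 <= (absp p)`_i.
Proof. by rewrite coef_absp nm_ge0. Qed.

Lemma le_horner (P Q : {poly R}) r : 0 <= r -> (forall i, P`_i <= Q`_i) ->
  P.[r] <= Q.[r].
Proof.
move=> r0 PQ; rewrite (horner_coef_wide _ (leq_maxl (size P) (size Q))).
rewrite (horner_coef_wide r (leq_maxr (size P) (size Q))).
by apply: ler_sum => i _; rewrite ler_wpM2r// exprn_ge0.
Qed.

Lemma le_horner2 (P : {poly R}) r s : 0 <= r -> r <= s ->
  (forall i, 0 <= P`_i) -> P.[r] <= P.[s].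
Proof.
move=> r0 rs P0; rewrite !horner_coef; apply: ler_sum => i _.
by rewrite ler_wpM2l// lerXn2r// nnegrE// (le_trans r0).
Qed.

(** The weighted l1 norm of the coefficients: submultiplicative, and above the modulus of [p] on the
    disk of radius [r]. *)
Definition cn r p : R := (absp p).[r].

Lemma cn_ge0 r p : 0 <= r -> 0 <= cn r p.
Proof.
by move=> r0; rewrite /cn -(horner0 r); apply: le_horner => // i;
  rewrite coef0 absp_ge0.
Qed.

Lemma cnD r p q : 0 <= r -> cn r (p + q) <= cn r p + cn r q.
Proof.
move=> r0; rewrite /cn -hornerD; apply: le_horner => // i.
by rewrite coefD !coef_absp coefD nmD.
Qed.

Lemma nm_sum (I : Type) (l : seq I) (P : pred I) (F : I -> C) :
  nm (\sum_(i <- l | P i) F i) <= \sum_(i <- l | P i) nm (F i).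
Proof.
elim/big_ind2: _ => [|x x' y y' hx hy|//]; first by rewrite nm0.
by rewrite (le_trans (nmD _ _))// lerD.
Qed.

Lemma cnM r p q : 0 <= r -> cn r (p * q) <= cn r p * cn r q.
Proof.
move=> r0; rewrite /cn -hornerM; apply: le_horner => // i.
rewrite coef_absp !coefM (le_trans (nm_sum _ _ _))//.
by apply: ler_sum => j _; rewrite nmM !coef_absp.
Qed.

Lemma cn_le r s p : 0 <= r -> r <= s -> cn r p <= cn s p.
Proof. by move=> r0 rs; apply: le_horner2 => // i; exact: absp_ge0. Qed.

Lemma absp0 : absp 0 = 0.
Proof. by apply/polyP => i; rewrite coef_absp !coef0 nm0. Qed.

Lemma absp_ind p c : absp (p * 'X + c%:P) = absp p * 'X + (nm c)%:P.
Proof.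
apply/polyP => i; rewrite coef_absp !coefD !coefMX !coefC coef_absp.
by case: i => [|i] /=; rewrite ?add0r ?addr0.
Qed.

Lemma cnC r c : cn r c%:P = nm c.
Proof. by rewrite -[c%:P]add0r -(mul0r 'X) /cn absp_ind absp0 mul0r add0r hornerC. Qed.

Lemma cnXn r n : cn r 'X^n = r ^+ n.
Proof.
rewrite /cn; suff -> : absp 'X^n = 'X^n by rewrite hornerXn.
apply/polyP => i; rewrite coef_absp !coefXn; case: eqP => _; by rewrite ?nm1 ?nm0.
Qed.

Lemma cnN r p : cn r (- p) = cn r p.
Proof.
rewrite /cn; congr horner; apply/polyP => i.
by rewrite !coef_absp coefN nmN.
Qed.

Lemma nm_horner r p z : nm z <= r -> nm p.[z] <= cn r p.
Proof.
move=> zr; have r0 := le_trans (nm_ge0 z) zr.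
rewrite /cn; elim/poly_ind: p => [|p c IH]; first by rewrite absp0 !horner0 nm0.
rewrite absp_ind !hornerE (le_trans (nmD _ _))// lerD2r nmM.
by rewrite ler_pM ?nm_ge0.
Qed.

Lemma nm_deriv_horner p z : nm (p^`()).[z] <= ((absp p)^`()).[nm z].
Proof.
elim/poly_ind: p => [|p c IH]; first by rewrite absp0 !deriv0 !horner0 nm0.
rewrite absp_ind !derivMXaddC !hornerE (le_trans (nmD _ _))// lerD//.
  exact: nm_horner.
by rewrite nmM ler_pM ?nm_ge0.
Qed.

(** Stated over any commutative ring so that one recursion, free of minus signs, serves both a
    complex polynomial and its real majorant [absp p]. *)
Definition taylor2 (K : comNzRingType) (p : {poly K}) (z h : K) : K :=
  p.[z + h] - p.[z] - h * (p^`()).[z].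

Lemma taylor2_ind (K : comNzRingType) (p : {poly K}) (c z h : K) :
  taylor2 (p * 'X + c%:P) z h = (z + h) * taylor2 p z h + h ^+ 2 * (p^`()).[z].
Proof. by rewrite /taylor2 !derivMXaddC !hornerE; ring. Qed.

Lemma taylor2_ge0 (P : {poly R}) (x s : R) : 0 <= x -> 0 <= s ->
  (forall i, 0 <= P`_i) -> 0 <= taylor2 P x s /\ 0 <= (P^`()).[x].
Proof.
move=> x0 s0; elim/poly_ind: P => [|P c IH] H.
  by rewrite /taylor2 deriv0 !horner0 mulr0 !subr0 lexx.
have H' : forall i, 0 <= P`_i.
  by move=> i; have := H i.+1; rewrite coefD coefMX coefC /= addr0.
have [h1 h2] := IH H'; rewrite taylor2_ind; split.
  by apply: addr_ge0; apply: mulr_ge0 => //; rewrite ?sqr_ge0 ?addr_ge0.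
have hP : 0 <= P.[x].
  by rewrite -(horner0 x); apply: le_horner => // i; rewrite coef0.
by rewrite derivMXaddC !hornerE; apply: addr_ge0 => //; apply: mulr_ge0.
Qed.

(* The absolute polynomial dominates [p] together with its Taylor remainder,
   so no Cauchy estimate is needed. *)
Lemma nm_taylor2 p z h s : 0 < s -> nm h <= s ->
  nm (taylor2 p z h) <= (nm h / s) ^+ 2 * cn (nm z + s) p.
Proof.
move=> s0 hs; have z0 := nm_ge0 z.
suff H : nm (taylor2 p z h) <= (nm h / s) ^+ 2 * taylor2 (absp p) (nm z) s.
  apply: (le_trans H); rewrite ler_wpM2l ?sqr_ge0//.
  have [_ h2] := taylor2_ge0 z0 (ltW s0) (absp_ge0 p).
  rewrite /taylor2 /cn -addrA gerDl -opprD oppr_le0 addr_ge0 ?mulr_ge0 ?(ltW s0)//.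
  exact: cn_ge0.
elim/poly_ind: p => [|p c IH].
  by rewrite absp0 /taylor2 !deriv0 !horner0 !mulr0 !subr0 nm0 mulr0.
rewrite absp_ind !taylor2_ind (le_trans (nmD _ _))// [leRHS]mulrDr lerD//.
  rewrite nmM mulrCA ler_pM ?nm_ge0//.
  by rewrite (le_trans (nmD _ _))// lerD2l.
rewrite nmM nmX mulrA -exprMn divfK ?gt_eqF// ler_wpM2l ?sqr_ge0//.
exact: nm_deriv_horner.
Qed.

(** When the coefficients of [P] are nonnegative its Taylor remainder is too, so
    [s * P'(x) <= P(x + s)]; this is applied to [absp p]. *)
Lemma nm_deriv p z s : 0 < s -> nm (p^`()).[z] <= cn (nm z + s) p / s.
Proof.
move=> s0; have z0 := nm_ge0 z.
rewrite ler_pdivlMr// (le_trans (ler_wpM2r (ltW s0) (nm_deriv_horner _ _)))//.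
have [h1 h2] := taylor2_ge0 z0 (ltW s0) (absp_ge0 p).
move: h1; rewrite /taylor2 /cn -addrA -opprD subr_ge0 => h.
by apply: le_trans h; rewrite mulrC lerDr cn_ge0.
Qed.

(** ['X^N] has norm at most 1 when [r <= 1], so the bound is uniform in [N]; the correction step
    fixes it before choosing the exponent. *)
Lemma cn_compXn p : exists2 B : R, 0 <= B & forall N (r : R), 0 <= r <= 1 ->
  cn r (p \Po 'X^N) <= B.
Proof.
elim/poly_ind: p => [|p c [B B0 IH]].
  by exists 0 => // N r _; rewrite comp_poly0 /cn absp0 horner0.
exists (B + nm c) => [|N r r01]; first by rewrite addr_ge0 ?nm_ge0.
rewrite comp_polyD comp_polyM comp_polyX comp_polyC.
have /andP[r0 r1] := r01.
rewrite (le_trans (cnD _ _ r0))// cnC lerD2r (le_trans (cnM _ _ r0))//.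
rewrite cnXn -[B]mulr1 ler_pM ?cn_ge0 ?exprn_ge0 ?IH//.
by rewrite exprn_ile1.
Qed.

End CoefNorm.

(** * Pole pushing and peak polynomials *)

Section PolePushing.
Variable R : realType.
Local Notation C := (Cplx R).
Implicit Types (S : set C) (h u y : C -> C).

Definition poly_approx S h := forall e : R, 0 < e ->
  exists p : {poly C}, forall z, S z -> nm (p.[z] - h z) <= e.

Lemma poly_approx_ext S h u : (forall z, S z -> h z = u z) ->
  poly_approx S h -> poly_approx S u.
Proof.
by move=> hu H e /H[p pe]; exists p => z Sz; rewrite -hu// pe.
Qed.

Lemma poly_approx_lim S h :
  (forall e : R, 0 < e -> exists2 g, poly_approx S g &
     forall z, S z -> nm (g z - h z) <= e) -> poly_approx S h.
Proof.
move=> H e e0; have e20 : 0 < e / 2 by rewrite divr_gt0.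
have [g /(_ _ e20)[p pg] gh] := H _ e20; exists p => z Sz.
by rewrite (le_trans (nm_triangle (g z) _ _))// [leRHS](Num.Theory.splitr e) lerD ?pg ?gh.
Qed.

Lemma poly_approxD S h u : poly_approx S h -> poly_approx S u ->
  poly_approx S (fun z => h z + u z).
Proof.
move=> Hh Hu e e0; have e20 : 0 < e / 2 by rewrite divr_gt0.
have [p ph] := Hh _ e20; have [q qu] := Hu _ e20; exists (p + q) => z Sz.
rewrite hornerD opprD addrACA (le_trans (nmD _ _))//.
by rewrite [leRHS](Num.Theory.splitr e) lerD ?ph ?qu.
Qed.

Lemma nm_subM (a b c d : C) :
  nm (a * b - c * d) <= nm a * nm (b - d) + nm (a - c) * nm d.
Proof.
rewrite -!nmM; apply: le_trans (nmD _ _); rewrite le_eqVlt; apply/orP; left.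
by apply/eqP; congr nm; ring.
Qed.

Lemma poly_approxM S h u (B : R) : poly_approx S h -> poly_approx S u ->
  (forall z, S z -> nm (h z) <= B) -> (forall z, S z -> nm (u z) <= B) ->
  poly_approx S (fun z => h z * u z).
Proof.
move=> Hh Hu hB uB e e0.
pose B1 := `|B| + 1; have B10 : 0 < B1 by rewrite ltr_wpDl.
have BB1 : B <= B1 by rewrite (le_trans (ler_norm B))// lerDl.
have B110 : 0 < B1 + 1 := addr_gt0 B10 ltr01.
pose d := Num.min 1 (e / 2 / (B1 + 1)).
have d0 : 0 < d by rewrite /d lt_min ltr01/= !divr_gt0.
have d1 : d <= 1 by rewrite /d ge_min lexx.
have de : d * (B1 + 1) <= e / 2.
  by rewrite -ler_pdivlMr// /d ge_min lexx orbT.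
have [p ph] := Hh _ d0; have [q qu] := Hu _ d0; exists (p * q) => z Sz.
have pB : nm p.[z] <= B1 + 1.
  rewrite -[p.[z]](subrK (h z)) (le_trans (nmD _ _))// addrC lerD//.
    by rewrite (le_trans (hB _ Sz)).
  exact: le_trans (ph _ Sz) d1.
rewrite hornerM (le_trans (nm_subM _ _ _ _))// [leRHS](Num.Theory.splitr e) lerD//.
  apply: le_trans de; rewrite mulrC ler_pM ?nm_ge0//; exact: qu.
apply: le_trans de; rewrite ler_pM ?nm_ge0 ?ph//.
by rewrite (le_trans (uB _ Sz))// (le_trans BB1)// lerDl.
Qed.

Lemma poly_approx_geo S y n : poly_approx S y ->
  (forall z, S z -> nm (y z) <= 1) ->
  poly_approx S (fun z => \sum_(i < n) y z ^+ i).
Proof.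
move=> Hy y1.
have HX k : poly_approx S (fun z => y z ^+ k).
  elim: k => [|k IH].
    by move=> e e0; exists 1 => z _; rewrite hornerC subrr nm0 ltW.
  apply: (@poly_approx_ext _ (fun z => y z * y z ^+ k)).
    by move=> z _; rewrite exprS.
  apply: (@poly_approxM _ _ _ 1) => // z Sz.
  by rewrite nmX exprn_ile1 ?nm_ge0// y1.
elim: n => [|n IH].
  by move=> e e0; exists 0 => z _; rewrite big_ord0 horner0 subrr nm0 ltW.
apply: (@poly_approx_ext _ (fun z => \sum_(i < n) y z ^+ i + y z ^+ n)).
  by move=> z _; rewrite big_ord_recr.
exact: poly_approxD.
Qed.

Lemma geo_half (y : C) n : nm y <= 2^-1 ->
  nm (\sum_(i < n) y ^+ i - (1 - y)^-1) <= 2 * 2^-1 ^+ n.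
Proof.
move=> yh.
have h1 : 2^-1 <= nm (1 - y).
  have := nmD (1 - y) y; rewrite subrK nm1 => h.
  have : (1 : R) = 2^-1 + 2^-1 by rewrite [LHS]Num.Theory.splitr mul1r.
  by move: h yh; lra.
have y1 : 1 - y != 0 by rewrite -nm_gt0 (lt_le_trans _ h1)// invr_gt0.
suff -> : \sum_(i < n) y ^+ i - (1 - y)^-1 = - (y ^+ n / (1 - y)).
  rewrite nmN nmM nmX nmV mulrC ler_pM ?invr_ge0 ?exprn_ge0 ?nm_ge0//.
    by rewrite -[leRHS]invrK lef_pV2// posrE ?invr_gt0// (lt_le_trans _ h1)// invr_gt0.
  by rewrite lerXn2r// nnegrE ?nm_ge0// invr_ge0.
have h : (\sum_(i < n) y ^+ i) * (1 - y) = 1 - y ^+ n.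
  by rewrite mulrC -[1 - y ^+ n]opprB (subrX1 y n) -mulNr opprB.
by rewrite -[X in X - _](mulfK y1) h mulrBl mul1r addrC addKr.
Qed.

(** The geometric series in [y] converges uniformly because [y] has modulus at most 1/2. One use of
    it moves a pole by one step. *)
Lemma poly_approx_neumann S u y (B : R) : poly_approx S u -> poly_approx S y ->
  (forall z, S z -> nm (u z) <= B) -> (forall z, S z -> nm (y z) <= 2^-1) ->
  poly_approx S (fun z => u z / (1 - y z)).
Proof.
move=> Hu Hy uB yh; apply: poly_approx_lim => e e0.
pose B1 := `|B| + 2; have B10 : 0 < B1 by rewrite ltr_wpDl.
have BB1 : B <= B1 by rewrite (le_trans (ler_norm B))// lerDl.
have [n nB] : exists n, B1 * (2 * 2^-1 ^+ n) <= e.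
  have h : (2^-1 : R) ^+ n @[n --> \oo] --> (0 : R).
    by apply: cvg_expr; rewrite ger0_norm ?invr_ge0// invf_lt1// ltr1n.
  have : 0 < e / (2 * B1) by rewrite divr_gt0// mulr_gt0.
  move/cvgr0_norm_le: h => /[apply] -[n _ /(_ n (leqnn n))]/=.
  rewrite ger0_norm ?exprn_ge0 ?invr_ge0// ler_pdivlMr ?mulr_gt0// => h.
  by exists n; rewrite mulrA mulrC [B1 * _]mulrC.
have y1 : forall z, S z -> nm (y z) <= 1.
  by move=> z /yh h; rewrite (le_trans h)// invf_le1// ler1n.
exists (fun z => u z * \sum_(i < n) y z ^+ i); last first.
  move=> z Sz; rewrite -mulrBr nmM (le_trans _ nB)// ler_pM ?nm_ge0//.
    by rewrite (le_trans (uB _ Sz)).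
  exact/geo_half/yh.
apply: (@poly_approxM _ _ _ (Num.max B n%:R)) => //.
- exact: poly_approx_geo.
- by move=> z Sz; rewrite le_max uB.
- move=> z Sz; rewrite le_max; apply/orP; right; apply: (le_trans (nm_sum _ _ _)).
  rewrite -[X in X%:R]card_ord -sumr_const ler_sum// => i _.
  by rewrite nmX exprn_ile1 ?nm_ge0// y1.
Qed.

(* Closed unit disk minus a wedge around the positive real axis: the condition
   says that the distance from [a] to [z] is at least [s * a]. *)
Definition slit_disk (s : R) : set C :=
  [set z | nm z <= 1 /\ forall a : R, 0 < a -> s * a <= nm (RtoC a - z)].

Lemma slit_disk_neq (s a : R) z : 0 < s -> 0 < a -> slit_disk s z -> RtoC a - z != 0.
Proof.
move=> s0 a0 [_ /(_ a a0) h].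
by rewrite -nm_gt0 (lt_le_trans _ h)// mulr_gt0.
Qed.

(* The pole is pushed along the positive axis out of the disk, multiplying its
   position by [1 + s / 2] each time. *)
Lemma poly_approx_pole (s a : R) : 0 < s < 1 -> 0 < a ->
  poly_approx (slit_disk s) (fun z => (RtoC a - z)^-1).
Proof.
move=> /andP[s0 s1] a0.
have [n] : exists n : nat, 2 <= a * (1 + s / 2) ^+ n.
  have [n hn] : exists n : nat, 2 / a <= 1 + n%:R * (s / 2).
    have := archi_boundP (x := 2 / a / (s / 2)).
    rewrite !divr_ge0 ?(ltW a0) ?(ltW s0)// => /(_ isT).
    rewrite ltr_pdivrMr ?divr_gt0// => h.
    by exists (Num.bound (2 / a / (s / 2))); rewrite (le_trans (ltW h))// lerDr.
  exists n; rewrite mulrC -ler_pdivrMr// (le_trans hn)//.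
  elim: n {hn} => [|n IH]; first by rewrite mul0r addr0 expr0.
  rewrite exprS; have h : 0 <= (1 + s / 2) ^+ n by rewrite exprn_ge0//; lra.
  have h1 : 0 <= n%:R :> R by [].
  rewrite -natr1; nra.
elim: n a a0 => [|n IH] a a0.
  (* A pole at [a >= 2] is expanded in powers of [z / a], of modulus at most 1/2 on the closed
     disk. *)
  rewrite expr0 mulr1 => a2.
  have a_neq0 : RtoC a != 0 by rewrite -nm_gt0 nm_RtoC gtr0_norm.
  apply: (@poly_approx_ext _ (fun z => (RtoC a)^-1 / (1 - z / RtoC a))).
    move=> z Sz; rewrite -invfM; congr (_^-1).
    by rewrite mulrBr mulr1 mulrCA divff// mulr1.
  apply: (@poly_approx_neumann _ _ _ (nm (RtoC a)^-1)) => //.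
  - by move=> e e0; exists ((RtoC a)^-1)%:P => z _; rewrite hornerC subrr nm0 ltW.
  - move=> e e0; exists ('X * ((RtoC a)^-1)%:P) => z _.
    by rewrite !hornerE subrr nm0 ltW.
  - move=> z [z1 _]; rewrite nmM nmV nm_RtoC gtr0_norm// -[leRHS]mul1r.
    by rewrite ler_pM ?nm_ge0 ?invr_ge0 ?(ltW a0)// lef_pV2 ?posrE.
rewrite exprS mulrA => h.
set a' := a * (1 + s / 2); have a'0 : 0 < a' by rewrite /a' pmulr_rgt0//; lra.
have aa' : a < a' by rewrite /a'; nra.
have Ha' := IH a' a'0 h; have sa'0 := mulr_gt0 s0 a'0.
have bnd z : slit_disk s z -> nm (RtoC a' - z)^-1 <= (s * a')^-1.
  move=> /= Sz; rewrite nmV lef_pV2 ?posrE//.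
    by case: Sz => _; exact.
  by rewrite nm_gt0 (slit_disk_neq s0 a'0).
(* Expansion around the pushed pole: the ratio [(a' - a) / (a' - z)] has modulus at most
   [(s / 2) * a / (s * a')], hence at most 1/2. *)
apply: (@poly_approx_ext _
  (fun z => (RtoC a' - z)^-1 / (1 - RtoC (a' - a) * (RtoC a' - z)^-1))).
  move=> z Sz; have hz' := slit_disk_neq s0 a'0 Sz.
  rewrite -invfM mulrBr mulr1 mulrCA divff// mulr1; congr (_^-1).
  by rewrite -{1}[a'](subrK a) RtoCD; ring.
apply: (@poly_approx_neumann _ _ _ (s * a')^-1) => //.
  apply: (@poly_approxM _ _ _ (Num.max (a' - a) (s * a')^-1)) => //.
  - by move=> e e0; exists (RtoC (a' - a))%:P => z _; rewrite hornerC subrr nm0 ltW.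
  - by move=> z _; rewrite nm_RtoC le_max ger0_norm ?lexx// subr_ge0 ltW.
  - by move=> z Sz; rewrite le_max bnd ?orbT.
move=> z Sz; rewrite nmM nm_RtoC ger0_norm ?subr_ge0 ?(ltW aa')//.
rewrite (le_trans (ler_wpM2l _ (bnd z Sz))) ?subr_ge0 ?(ltW aa')//.
rewrite ler_pdivrMr// /a'.
have : 0 < s * a by rewrite mulr_gt0.
have : 0 < s * (s * a) by rewrite !mulr_gt0.
nra.
Qed.

(** The model is [a / (a - z)] for small [a]: it equals 1 at 0, is bounded by [1 / s] off the wedge
    by the very definition of [slit_disk], and is at most [2 * a] on the circle, where
    [|a - z| >= 1/2]. The first bound is independent of [e]. *)
Lemma peak_poly (s : R) : 0 < s < 1 -> forall e : R, 0 < e ->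
  exists G : {poly C}, [/\ G.[0] = 1,
    forall z, slit_disk s z -> nm G.[z] <= s^-1 + 1 &
    forall z, slit_disk s z -> nm z = 1 -> nm G.[z] <= e].
Proof.
move=> s01 e e0; have /andP[s0 s1] := s01.
wlog e1 : e e0 / e <= 1.
  move=> H; have [||G [G0 Gs Ge]] := H (Num.min e 1).
  - by rewrite lt_min e0/=.
  - by rewrite ge_min lexx orbT.
  by exists G; split => // z Sz /(Ge _ Sz); rewrite le_min => /andP[].
(* The model costs [2 * a] on the circle, its approximation [a], and the constant that restores the
   value 1 at 0 another [a]. *)
set a := e / 4; have a0 : 0 < a by rewrite divr_gt0.
have [p pe] : exists p : {poly C}, forall z, slit_disk s z ->
    nm (p.[z] - RtoC a * (RtoC a - z)^-1) <= a.
  have [//|p pe] := poly_approx_pole s01 a0 (e := 1).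
  exists ((RtoC a)%:P * p) => z Sz; rewrite !hornerE -mulrBr nmM nm_RtoC gtr0_norm//.
  by rewrite -[leRHS]mulr1 ler_wpM2l ?pe// ltW.
have S0 : slit_disk s 0.
  split; first by rewrite nm0.
  move=> b b0; rewrite subr0 nm_RtoC gtr0_norm// -[leRHS]mul1r ler_pM2r// ltW//.
have a_neq0 : RtoC a != 0 by rewrite -nm_gt0 nm_RtoC gtr0_norm.
have p0 : nm (1 - p.[0]) <= a.
  by have := pe 0 S0; rewrite subr0 divff// nmB.
have bnd z : slit_disk s z ->
    nm (p + (1 - p.[0])%:P).[z] <= nm (RtoC a * (RtoC a - z)^-1) + 2 * a.
  move=> Sz; rewrite hornerD hornerC -[p.[z]](subrK (RtoC a * (RtoC a - z)^-1)).
  have h1 := nmD (p.[z] - RtoC a * (RtoC a - z)^-1 + RtoC a * (RtoC a - z)^-1)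
    (1 - p.[0]).
  have h2 := nmD (p.[z] - RtoC a * (RtoC a - z)^-1) (RtoC a * (RtoC a - z)^-1).
  have := pe z Sz; move: h1 h2 p0; lra.
exists (p + (1 - p.[0])%:P); split.
- by rewrite hornerD hornerC addrC subrK.
- move=> z Sz; apply: (le_trans (bnd z Sz)); apply: lerD; last by rewrite /a; lra.
  rewrite nmM nmV nm_RtoC gtr0_norm// ler_pdivrMr ?nm_gt0 ?(slit_disk_neq s0)//.
  by rewrite mulrC ler_pdivlMr// mulrC; case: Sz => _; exact.
- move=> z Sz z1; apply: (le_trans (bnd z Sz)).
  have h : 1 - a <= nm (RtoC a - z).
    rewrite lerBlDl -z1 -[z in nm z](subrK (RtoC a)) (le_trans (nmD _ _))//.
    by rewrite nm_RtoC gtr0_norm// nmB addrC.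
  have h1 : 1 / 2 <= nm (RtoC a - z) by apply: le_trans h; rewrite /a; lra.
  rewrite nmM nmV nm_RtoC gtr0_norm//.
  have : a / nm (RtoC a - z) <= 2 * a.
    rewrite ler_pdivrMr; last by apply: lt_le_trans h1; rewrite divr_gt0.
    nra.
  rewrite /a; lra.
Qed.

End PolePushing.

(** * Sets of small measure on the circle *)

Section SmallSets.
Variable R : realType.
Local Notation C := (Cplx R).
Local Notation mu := (@lebesgue_measure R).

(** Outer measure at most [d], so that exceptional sets need not be measurable. *)
Definition small (d : R) (E : set R) :=
  exists2 B : set (measurableTypeR R), measurable B & E `<=` B /\ (mu B <= d%:E)%E.

Lemma small_sub d e E F : F `<=` E -> d <= e -> small d E -> small e F.
Proof.
move=> FE de [B mB [EB Bd]]; exists B => //; split; first exact: subset_trans EB.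
by rewrite (le_trans Bd)// lee_fin.
Qed.

Lemma smallU d e E F : small d E -> small e F -> small (d + e) (E `|` F).
Proof.
move=> [A mA [EA Ad]] [B mB [FB Be]]; exists (A `|` B); first exact: measurableU.
split; first exact: setUSS.
by apply: le_trans (measureU2 mu mA mB) _; rewrite EFinD leeD.
Qed.

Lemma small_negligible E : mu.-negligible E -> small 0 E.
Proof. by move=> [B [mB B0 EB]]; exists B => //; split => //; rewrite B0. Qed.

Lemma small_bigU n d (E : nat -> set R) : (forall i, (i < n)%N -> small d (E i)) ->
  small (d *+ n) (\big[setU/set0]_(i < n) E i).
Proof.
elim: n => [|n IH] H.
  by rewrite big_ord0 mulr0n; exists set0 => //; split => //; rewrite measure0.
rewrite big_ord_recr mulrSr; apply: smallU; last exact: H.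
by apply: IH => i /ltnW; exact: H.
Qed.

Lemma small_itv (a b d : R) : b - a <= d -> 0 <= d -> small d `[a, b]%classic.
Proof.
move=> ab d0; exists `[a, b]%classic; first exact: measurable_itv.
split => //; rewrite lebesgue_measure_itv/= lte_fin; case: ifPn => _.
  by rewrite -EFinB lee_fin.
by rewrite lee_fin.
Qed.

Definition circ : set R := [set t | 0 <= t < 2 * pi].

Lemma sinDnpi (x : R) n : `|sin (x + n%:R * pi)| = `|sin x|.
Proof.
elim: n => [|n IH]; first by rewrite mul0r addr0.
by rewrite -natr1 mulrDl mul1r addrA sinDpi normrN.
Qed.

Lemma sin_ge (b x : R) : 0 <= b <= pi / 2 -> b <= x <= pi - b -> sin b <= sin x.
Proof.
move=> /andP[b0 b1] /andP[bx xb]; have p0 := pi_gt0 R.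
have mono y : b <= y <= pi / 2 -> sin b <= sin y.
  move=> /andP[bY y2]; rewrite leNgt ltr_sin -?leNgt// in_itv/=; apply/andP; split; lra.
have [x2|x2] := lerP x (pi / 2); first by apply: mono; rewrite bx.
have -> : sin x = sin (pi - x).
  by rewrite sinB sinpi cospi mul0r sub0r mulN1r opprK.
by apply: mono; apply/andP; split; lra.
Qed.

(** The distance from [a] to the line through 0 of direction [phi] is [a * |sin phi|]. *)
Lemma slit_disk_polar (s r phi : R) : 0 < s -> 0 <= r <= 1 -> s <= `|sin phi| ->
  slit_disk s (RtoC r * expi phi : C).
Proof.
move=> s0 /andP[r0 r1] sphi; split.
  by rewrite nmM nm_RtoC nm_expi mulr1 ger0_norm.
move=> a a0; apply: (@le_trans _ _ `|a * sin phi|).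
  by rewrite normrM gtr0_norm// mulrC ler_pM2l.
rewrite -(ler_pXn2r (n:=2)) ?nnegrE ?normr_ge0 ?nm_ge0//.
rewrite nm_sqr real_normK ?num_real//= !mul0r subr0 addr0 sub0r.
have := cos2Dsin2 phi => h.
have : 0 <= (r - a * cos phi) ^+ 2 by rewrite sqr_ge0.
suff -> : (a - r * cos phi) ^+ 2 + (- (r * sin phi)) ^+ 2 =
  (r - a * cos phi) ^+ 2 + (a * sin phi) ^+ 2 by lra.
have e1 : (cos phi) ^+ 2 = 1 - sin phi ^+ 2 by lra.
rewrite !exprMn sqrrN !sqrrB !exprMn e1; ring.
Qed.

(** A bad [t] has [N * t] within [b] of a multiple of [pi]. This leaves [2 * N + 1] intervals of
    length [2 * b / N], of total length at most [6 * b] whatever [N] is. *)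
Lemma slit_gap (d : R) : 0 < d -> exists2 s : R, 0 < s < 1 &
  forall N, (0 < N)%N -> small d [set t | circ t /\
     ~ (forall r : R, 0 <= r <= 1 -> slit_disk s ((RtoC r * expi t : C) ^+ N))].
Proof.
move=> d0; have p2 := pi_ge2 R.
pose b := Num.min 2^-1 (d / 6).
have b0 : 0 < b by rewrite /b lt_min divr_gt0// invr_gt0 ltr0n.
have b1 : b <= 2^-1 by rewrite /b ge_min lexx.
have bd : b <= d / 6 by rewrite /b ge_min lexx orbT.
have h2 : (2 : R) * 2^-1 = 1 by rewrite divff.
have sb : 0 < sin b by apply: sin_gt0_pi; apply/andP; split; lra.
exists (sin b / 2).
  by rewrite divr_gt0//= ltr_pdivrMr// mul1r (le_lt_trans (sin_le1 _))// ltr1n.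
move=> N N0.
have NR : 0 < N%:R :> R by rewrite ltr0n.
pose J k := `[(k%:R * pi - b) / N%:R, (k%:R * pi + b) / N%:R]%classic.
have sJ : small (2 * b / N%:R *+ (2 * N).+1) (\big[setU/set0]_(k < (2 * N).+1) J k).
  apply: small_bigU => k _; apply: small_itv; last by rewrite divr_ge0 ?mulr_ge0 ?(ltW b0)// ltW.
  by rewrite -mulrBl ler_pM2r ?invr_gt0//; lra.
apply: small_sub sJ; last first.
  rewrite -mulr_natr -mulrA mulrC; apply: (@le_trans _ _ (3 * (2 * b))); last by lra.
  rewrite ler_pM2r ?mulr_gt0// mulrC ler_pdivrMr//.
  have : 1 <= N%:R :> R by rewrite ler1n.
  rewrite -natr1 natrM; lra.
move=> t [/andP[t0 t2] Ht]; apply: contrapT => Et; apply: Ht => r r01.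
have tJ k : (k < (2 * N).+1)%N -> ~ J k t.
  by move=> kN Jk; apply: Et; exact: (bigsetU_sup kN) Jk.
have Nt0 : 0 <= t * N%:R by rewrite mulr_ge0// ltW.
(* [t * N] lies between [k * pi] and [(k + 1) * pi], so avoiding [J k] and [J k.+1] is enough. *)
pose k := Num.trunc (t * N%:R / pi).
have /andP[k1 k2] : k%:R <= t * N%:R / pi < k.+1%:R.
  by apply: truncn_itv; rewrite divr_ge0 ?pi_ge0.
rewrite ler_pdivlMr ?pi_gt0// in k1; rewrite ltr_pdivrMr ?pi_gt0// in k2.
have kN : (k < 2 * N)%N.
  rewrite -(ltr_nat R) natrM -(ltr_pM2r (pi_gt0 R)) (le_lt_trans k1)//.
  by rewrite mulrAC ltr_pM2r.
have sin_t : sin b <= `|sin (t * N%:R)|.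
  rewrite -[t * N%:R](subrK (k%:R * pi)) sinDnpi.
  rewrite (le_trans _ (ler_norm _))//; apply: sin_ge; first by apply/andP; split; lra.
  have h1 := tJ k (leq_trans kN (leqnSn _)).
  have h3 := tJ k.+1 (leq_ltn_trans kN (ltnSn _)).
  rewrite leNgt leNgt; apply/andP; split; apply/negP => h.
    apply: h1; rewrite /J /= in_itv/= ler_pdivrMr// ler_pdivlMr//.
    by apply/andP; split; lra.
  apply: h3; rewrite /J /= in_itv/= ler_pdivrMr// ler_pdivlMr//.
  by move: h k2; rewrite -natr1 mulrDl mul1r => h k2; apply/andP; split; lra.
rewrite exprMn expiX.
rewrite -RtoCX.
apply: slit_disk_polar; first by rewrite divr_gt0.
  by case/andP: r01 => r0 r1; rewrite exprn_ge0//= exprn_ile1.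
by rewrite (le_trans _ sin_t)// ler_pdivrMr// ler_peMr ?ltW// ltr1n.
Qed.

End SmallSets.

(** * Approximation in measure by polynomials *)

Section CircleApprox.
Variable R : realType.
Local Notation C := (Cplx R).
Local Notation mu := (@lebesgue_measure R).
Implicit Types (h g : R -> C).

(** Approximation in measure, with one [e] for the error and for the exceptional set. *)
Definition circle_approx h := forall e : R, 0 < e -> exists q : {poly C},
  small e [set t | circ t /\ ~ (nm (q.[expi t] - h t) <= e)].

Lemma circle_approx_lim h :
  (forall e : R, 0 < e -> exists2 g, circle_approx g &
     small e [set t | circ t /\ ~ (nm (g t - h t) <= e)]) -> circle_approx h.
Proof.
move=> H e e0; have e20 : 0 < e / 2 by rewrite divr_gt0.
have [g /(_ _ e20)[p pg] gh] := H _ e20; exists p.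
apply: small_sub (smallU pg gh); last by rewrite -Num.Theory.splitr.
move=> t [ct tp]; apply: contrapT => /not_orP[/= /not_andP[//|/contrapT t1]].
move=> /not_andP[//|/contrapT t2]; apply: tp.
by rewrite (le_trans (nm_triangle (g t) _ _))// [leRHS](Num.Theory.splitr e) lerD.
Qed.

Lemma circle_approx_ae h g :
  circle_approx g -> small 0 [set t | circ t /\ g t != h t] -> circle_approx h.
Proof.
move=> Hg H; apply: circle_approx_lim => e e0; exists g => //.
apply: small_sub (ltW e0) H => t [ct tp]; split => //; apply/eqP => gh.
by apply: tp; rewrite gh subrr nm0 ltW.
Qed.

Lemma small0 (d : R) : 0 <= d -> small d set0.
Proof. by move=> d0; exists set0 => //; split => //; rewrite measure0. Qed.

Lemma circle_approx_ext h g :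
  (forall t, circ t -> g t = h t) -> circle_approx g -> circle_approx h.
Proof.
move=> gh Hg; apply: (circle_approx_ae Hg); apply: small_sub (small0 (lexx 0)) => //.
by move=> t [/gh ->]; rewrite eqxx.
Qed.

Lemma circle_approx_poly (p : {poly C}) : circle_approx (fun t => p.[expi t]).
Proof.
move=> e e0; exists p; apply: small_sub (lexx e) (small0 (ltW e0)) => t [_].
by rewrite subrr nm0 (ltW e0); apply.
Qed.

Lemma circle_approx_cst (c : C) : circle_approx (fun=> c).
Proof.
by apply: circle_approx_ext (circle_approx_poly c%:P) => t _; rewrite hornerC.
Qed.

Lemma circle_approxD h g : circle_approx h -> circle_approx g ->
  circle_approx (fun t => h t + g t).
Proof.
move=> Hh Hg e e0; have e20 : 0 < e / 2 by rewrite divr_gt0.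
have [p ph] := Hh _ e20; have [q qg] := Hg _ e20; exists (p + q).
apply: small_sub (smallU ph qg); last by rewrite -Num.Theory.splitr.
move=> t [ct tp]; apply: contrapT => /not_orP[/= /not_andP[//|/contrapT t1]].
move=> /not_andP[//|/contrapT t2]; apply: tp.
rewrite hornerD opprD addrACA (le_trans (nmD _ _))//.
by rewrite [leRHS](Num.Theory.splitr e) lerD.
Qed.

(** Neither factor is bounded, but off a small set [g] is close to a polynomial [q0], which is
    bounded on the circle. The resulting bound on [g] sets the accuracy of [q1], and the bound on
    [q1] sets that of [q2]. *)
Lemma circle_approxM h g : circle_approx h -> circle_approx g ->
  circle_approx (fun t => h t * g t).
Proof.
move=> Hh Hg e e0; have e40 : 0 < e / 4 by rewrite divr_gt0.
have one_circ t : nm (expi t : C) <= 1 by rewrite nm_expi.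
have [q0 q0g] := Hg _ e40.
pose B2 := cn 1 q0 + e / 4.
have B20 : 0 < B2 by rewrite /B2 ltr_wpDl// cn_ge0.
have B2P t : nm (q0.[expi t] - g t) <= e / 4 -> nm (g t) <= B2.
  move=> h1; rewrite -[g t](subKr q0.[expi t]) (le_trans (nmD _ _))// nmN.
  by rewrite lerD// nm_horner.
pose d1 := Num.min (e / 4) (e / 2 / B2).
have d10 : 0 < d1 by rewrite /d1 lt_min e40/= !divr_gt0.
have [q1 q1h] := Hh _ d10.
pose B1 := cn 1 q1 + 1.
have B10 : 0 < B1 by rewrite /B1 ltr_wpDl// cn_ge0.
pose d2 := Num.min (e / 4) (e / 2 / B1).
have d20 : 0 < d2 by rewrite /d2 lt_min e40/= !divr_gt0.
have [q2 q2g] := Hg _ d20; exists (q1 * q2).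
apply: small_sub (smallU (smallU q0g q1h) q2g); last first.
  have : d1 <= e / 4 by rewrite /d1 ge_min lexx.
  have : d2 <= e / 4 by rewrite /d2 ge_min lexx.
  lra.
move=> t [ct tp]; apply: contrapT => /not_orP[/not_orP[]].
move=> /= /not_andP[//|/contrapT t0] /not_andP[//|/contrapT t1].
move=> /not_andP[//|/contrapT t2]; apply: tp.
rewrite hornerM (le_trans (nm_subM _ _ _ _))// [leRHS](Num.Theory.splitr e) lerD//.
  apply: (@le_trans _ _ (B1 * (e / 2 / B1))); last by rewrite mulrC divfK// gt_eqF.
  rewrite ler_pM ?nm_ge0//; first by rewrite (le_trans (nm_horner _ (one_circ t)))// lerDl.
  by rewrite (le_trans t2)// /d2 ge_min lexx orbT.
apply: (@le_trans _ _ (e / 2 / B2 * B2)); last by rewrite divfK// gt_eqF.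
rewrite ler_pM ?nm_ge0 ?B2P//.
by rewrite (le_trans t1)// /d1 ge_min lexx orbT.
Qed.

Lemma circle_approxX h n : circle_approx h -> circle_approx (fun t => h t ^+ n).
Proof.
move=> Hh; elim: n => [|n IH].
  by apply: circle_approx_ext (circle_approx_cst 1) => t _; rewrite expr0.
by apply: circle_approx_ext (circle_approxM Hh IH) => t _; rewrite exprS.
Qed.

Lemma circle_approx_sum n (h : nat -> R -> C) : (forall i, circle_approx (h i)) ->
  circle_approx (fun t => \sum_(i < n) h i t).
Proof.
move=> Hh; elim: n => [|n IH].
  by apply: circle_approx_ext (circle_approx_cst 0) => t _; rewrite big_ord0.
by apply: circle_approx_ext (circle_approxD IH (Hh n)) => t _; rewrite big_ord_recr.
Qed.

(* [(1 - G) / 'X] for a peak polynomial [G] is close to [1 / 'X] off the slit. *)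
Lemma circle_approx_expiN : circle_approx (fun t => expi (- t)).
Proof.
move=> e e0; have [s s01 /(_ 1 isT) gap] := slit_gap e0.
have [G [G0 _ Ge]] := peak_poly s01 e0.
have /factor_theorem[P PG] : root (1 - G) 0 by rewrite rootE !hornerE G0 subrr.
exists P; apply: small_sub (lexx e) gap => t [ct tp]; split => // H; apply: tp.
have r1 : 0 <= (1 : R) <= 1 by apply/andP; split.
have := H 1 r1; have -> : RtoC 1 = 1 :> C by [].
rewrite mul1r expr1 => /Ge; rewrite nm_expi => /(_ erefl) GE.
have -> : P.[expi t] - expi (- t) = - G.[expi t] * expi (- t).
  have : (1 - G).[expi t] = P.[expi t] * expi t.
    by rewrite PG hornerM hornerXsubC subr0.
  rewrite !hornerE => h.
  rewrite -[P.[expi t]]mulr1 -(expiN t) mulrA -h; ring.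
by rewrite nmM nmN nm_expi mulr1.
Qed.

Lemma circle_approx_cos (m : R) : circle_approx (fun t => RtoC (cos (t - m))).
Proof.
have H1 : circle_approx (fun t => RtoC 2^-1 * expi (- m) * expi t).
  apply: circle_approxM; first exact: circle_approx_cst.
  by apply: circle_approx_ext (circle_approx_poly 'X) => t _; rewrite hornerX.
have H2 : circle_approx (fun t => RtoC 2^-1 * expi m * expi (- t)).
  by apply: circle_approxM; [exact: circle_approx_cst|exact: circle_approx_expiN].
apply: circle_approx_ext (circle_approxD H1 H2) => t _.
rewrite -!mulrA -!expiD -mulrDr.
have -> : - m + t = t - m by rewrite addrC.
rewrite -(opprB t m) /RtoC /expi cosN sinN.
apply/eqP; rewrite eq_complex /= addrN !mulr0 !mul0r subr0 addr0 eqxx andbT.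
by apply/eqP; lra.
Qed.

Lemma pow_small (x e : R) : 0 <= x < 1 -> 0 < e -> exists N, forall n, (N <= n)%N -> x ^+ n <= e.
Proof.
move=> /andP[x0 x1] e0.
have h : x ^+ n @[n --> \oo] --> (0 : R) by apply: cvg_expr; rewrite ger0_norm.
move/cvgr0_norm_le: h => /(_ _ e0)[N _ H]; exists N => n Nn.
by have := H n Nn; rewrite /= ger0_norm// exprn_ge0.
Qed.

Lemma bernoulli (x : R) n : -1 <= x -> 1 + n%:R * x <= (1 + x) ^+ n.
Proof.
move=> x1; elim: n => [|n IH]; first by rewrite mul0r addr0 expr0.
rewrite exprS -natr1.
have n0 : 0 <= n%:R :> R by [].
have h := ler_wpM2l (_ : 0 <= 1 + x) IH.
apply: le_trans (h _); last by lra.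
have : 0 <= n%:R * x ^+ 2 by rewrite mulr_ge0// sqr_ge0.
rewrite expr2; lra.
Qed.

(* The polynomials [(1 - y ^ n) ^ (2 ^ n)] tend to 1 for [y < 1/2] and to 0 for
   [y > 1/2], as in the proof of the Stone-Weierstrass theorem. *)
Lemma circle_approx_threshold (y : R -> R) : circle_approx (fun t => RtoC (y t)) ->
  (forall t, 0 <= y t <= 1) ->
  (forall e : R, 0 < e -> exists2 k : R, 0 < k &
     small e [set t | circ t /\ `|y t - 2^-1| < k]) ->
  circle_approx (fun t => RtoC ((y t < 2^-1)%R%:R)).
Proof.
move=> Hy y01 Hk; apply: circle_approx_lim => e e0.
have [k' k'0 sk'] := Hk e e0.
pose k := Num.min k' 4^-1.
have k0 : 0 < k by rewrite /k lt_min k'0/= invr_gt0.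
have k4 : k <= 4^-1 by rewrite /k ge_min lexx orbT.
have kk : k <= k' by rewrite /k ge_min lexx.
have [N1 HN1] : exists N, forall n, (N <= n)%N -> (1 - 2 * k) ^+ n <= e.
  by apply: pow_small => //; apply/andP; split; lra.
have [N2 HN2] : exists N, forall n, (N <= n)%N -> ((1 + 2 * k)^-1) ^+ n <= e.
  apply: pow_small => //; rewrite invr_ge0; apply/andP; split; first by lra.
  by rewrite invf_lt1; lra.
pose n := maxn N1 N2.
have {}HN1 := HN1 n (leq_maxl _ _); have {}HN2 := HN2 n (leq_maxr _ _).
exists (fun t => (1 - RtoC (y t) ^+ n) ^+ (2 ^ n)).
  apply: circle_approxX.
  have H : circle_approx (fun t => 1 + (-1) * RtoC (y t) ^+ n).
    apply: circle_approxD; first exact: circle_approx_cst.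
    by apply: circle_approxM; [exact: circle_approx_cst|exact: circle_approxX].
  by apply: circle_approx_ext H => t _; rewrite mulN1r.
apply: small_sub (lexx e) sk' => t [ct tp]; split => //.
rewrite ltNge; apply/negP => yk; apply: tp; rewrite -RtoCX.

have -> : 1 - RtoC (y t ^+ n) = RtoC (1 - y t ^+ n).
  by apply: (addIr (RtoC (y t ^+ n))); rewrite subrK -RtoCD subrK.
rewrite -RtoCX -RtoCB nm_RtoC.
have /andP[y0 y1] := y01 t.
set x := y t ^+ n.
have x0 : 0 <= x by rewrite exprn_ge0.
have x1 : x <= 1 by rewrite exprn_ile1.
have B0 : 0 <= (1 - x) ^+ (2 ^ n) by rewrite exprn_ge0// subr_ge0.
have B1 : (1 - x) ^+ (2 ^ n) <= 1 by rewrite exprn_ile1// ?subr_ge0// gerBl.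
(* The exponents are matched so that Bernoulli's inequality brings in [(2 * y) ^ n], which tends to
   0 or to infinity on the two sides of 1/2. *)
have n2 : (2 ^ n)%:R * x = (2 * y t) ^+ n by rewrite natrX exprMn.
case: (ltrP (y t) 2^-1) => yh.
  have {}yk : y t <= 2^-1 - k.
    by move: yk; rewrite ler0_norm ?subr_le0 ?(ltW yh)//; lra.
  rewrite distrC ger0_norm ?subr_ge0//.
  have : 1 - (2 * y t) ^+ n <= (1 - x) ^+ (2 ^ n).
    by rewrite -n2 -mulrN; apply: bernoulli; lra.
  have : (2 * y t) ^+ n <= (1 - 2 * k) ^+ n by rewrite lerXn2r ?nnegrE; lra.
  move: HN1; rewrite mulr1n; lra.
have {}yk : 2^-1 + k <= y t.
  by move: yk; rewrite ger0_norm ?subr_ge0//; lra.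
rewrite subr0 ger0_norm//; apply: le_trans HN2.
have h1 : (1 + 2 * k) ^+ n <= (1 + x) ^+ (2 ^ n).
  apply: (@le_trans _ _ (1 + (2 ^ n)%:R * x)).
    rewrite n2 (@le_trans _ _ ((2 * y t) ^+ n)) ?lerDr//.
    by rewrite lerXn2r ?nnegrE; lra.
  by apply: bernoulli; lra.
(* [(1 - x) * (1 + x) <= 1] turns the lower bound on the power of [1 + x] into an upper bound on
   that of [1 - x]. *)
have h2 : (1 - x) ^+ (2 ^ n) * (1 + x) ^+ (2 ^ n) <= 1.
  rewrite -exprMn -subr_sqr expr1n exprn_ile1//.
    by rewrite subr_ge0 exprn_ile1.
  by rewrite gerBl sqr_ge0.
rewrite exprVn -[leRHS]mul1r ler_pdivlMr; last by rewrite exprn_gt0//; lra.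
by apply: le_trans h2; rewrite ler_wpM2l.
Qed.


Lemma cos_lt (u v : R) : 0 <= u -> u < v -> v <= pi -> cos v < cos u.
Proof. by move=> u0 uv vp; rewrite ltr_cos// in_itv/=; apply/andP; split; lra. Qed.

Lemma cos_2piB (u : R) : cos (2 * pi - u) = cos u.
Proof.
have -> : 2 * pi - u = - u + pi *+ 2 by rewrite mulr_natl addrC.
by rewrite cosD2pi cosN.
Qed.

(** The arc from 0 to [b] is where [cos (t - b / 2)] exceeds [cos (b / 2)]; [y] rescales the
    difference into [[0, 1]] with threshold 1/2. *)
Lemma circle_approx_lt (b : R) : 0 < b < 2 * pi ->
  circle_approx (fun t => RtoC ((t < b)%R%:R)).
Proof.
move=> /andP[b0 b2]; have p0 := pi_gt0 R.
pose y t : R := 2^-1 + (cos (b / 2) - cos (t - b / 2)) / 4.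
have yin k t : 0 <= k -> k < t -> t < b - k -> cos (b / 2 - k) < cos (t - b / 2).
  move=> k0 kt tb; have [h|h] := lerP (b / 2) t; first by apply: cos_lt; lra.
  by rewrite -(cosN (t - b / 2)); apply: cos_lt; lra.
have yout k t : 0 <= k -> b + k < t -> t < 2 * pi - k -> cos (t - b / 2) < cos (b / 2 + k).
  move=> k0 kt tb; have [h|h] := lerP (t - b / 2) pi; first by apply: cos_lt; lra.
  by rewrite -(cos_2piB (t - b / 2)); apply: cos_lt; lra.
have y01 t : 0 <= y t <= 1.
  have := cos_le1 (b / 2); have := cos_geN1 (b / 2).
  have := cos_le1 (t - b / 2); have := cos_geN1 (t - b / 2).
  by rewrite /y => *; apply/andP; split; lra.
have Hy : circle_approx (fun t => RtoC (y t)).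
  have H : circle_approx (fun t => RtoC (2^-1 + cos (b / 2) / 4) +
      RtoC (- 4^-1) * RtoC (cos (t - b / 2))).
    apply: circle_approxD; first exact: circle_approx_cst.
    apply: circle_approxM; first exact: circle_approx_cst.
    exact: circle_approx_cos.
  apply: circle_approx_ext H => t _; rewrite -RtoCM -RtoCD; congr RtoC.
  by rewrite /y; lra.
have Hk e : 0 < e -> exists2 k : R, 0 < k &
     small e [set t | circ t /\ `|y t - 2^-1| < k].
  (* [y] is near 1/2 only near 0, [b] and [2 * pi]; margins [k] there have total length
     [4 * k <= e]. *)
  move=> e0; pose k := Num.min (e / 4) (Num.min (b / 4) ((2 * pi - b) / 4)).
  have k0 : 0 < k by rewrite /k !lt_min !divr_gt0// subr_gt0.
  have ke : k <= e / 4 by rewrite /k ge_min lexx.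
  have kb : k <= b / 4 by rewrite /k !ge_min lexx !orbT.
  have kp : k <= (2 * pi - b) / 4 by rewrite /k !ge_min lexx !orbT.
  pose c1 := cos (b / 2 - k) - cos (b / 2); pose c2 := cos (b / 2) - cos (b / 2 + k).
  have c10 : 0 < c1 by rewrite /c1 subr_gt0; apply: cos_lt; lra.
  have c20 : 0 < c2 by rewrite /c2 subr_gt0; apply: cos_lt; lra.
  pose k' := Num.min c1 c2 / 4.
  have k1 : k' <= c1 / 4 by rewrite /k' ler_pM2r ?invr_gt0// ge_min lexx.
  have k2 : k' <= c2 / 4 by rewrite /k' ler_pM2r ?invr_gt0// ge_min lexx orbT.
  exists k'; first by rewrite /k' divr_gt0// lt_min c10.
  have s1 : small k `[0, k]%classic by apply: small_itv; lra.
  have s2 : small (2 * k) `[b - k, b + k]%classic by apply: small_itv; lra.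
  have s3 : small k `[2 * pi - k, 2 * pi]%classic by apply: small_itv; lra.
  apply: small_sub (smallU (smallU s1 s2) s3); last by lra.
  move=> t [/andP[t0 t2] yk]; apply: contrapT => /not_orP[/not_orP[]].
  rewrite /= !in_itv/= t0/= (ltW t2) andbT => /negP; rewrite -ltNge => tk.
  move=> /negP; rewrite negb_and -!ltNge => tb /negP; rewrite -ltNge => tp.
  move: yk; rewrite ltNge => /negP; apply.
  have [h|h] := orP tb.
    have := yin k t (ltW k0) tk h; rewrite -subr_gt0 => h1.
    rewrite ler0_norm; last by rewrite /y /c1 in c10 *; lra.
    by apply: (le_trans k1); rewrite /y /c1; lra.
  have := yout k t (ltW k0) h tp; rewrite -subr_gt0 => h1.
  rewrite ger0_norm; last by rewrite /y /c2 in c20 *; lra.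
  by apply: (le_trans k2); rewrite /y /c2; lra.
apply: (circle_approx_ae (circle_approx_threshold Hy y01 Hk)).

(* At [t = 0] the value of [y] is exactly 1/2, so the two indicators differ at that one point. *)
have s0 : small 0 (`[0 : R, 0]%classic) by apply: small_itv; lra.
apply: small_sub (lexx 0) s0 => t [/andP[t0 t2] tb].
rewrite /= in_itv/= t0/= leNgt; apply/negP => tgt0; move/eqP: tb; apply; congr (RtoC _%:R).
congr (nat_of_bool _).
have [tb|tb|->] := ltrgtP t b.
- have := yin 0 t (lexx 0) tgt0; rewrite !subr0 => /(_ tb).
  by rewrite /y => h; apply/idP; lra.
- have := yout 0 t (lexx 0); rewrite !addr0 subr0 => /(_ tb t2).
  by rewrite /y => h; apply/negbTE; rewrite -leNgt; lra.
- rewrite /y; have -> : b - b / 2 = b / 2 by lra.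
  by rewrite subrr mul0r addr0 ltxx.
Qed.

Definition ind (A : set R) (t : R) : C := RtoC (`[< A t >])%:R.

Lemma indT (A : set R) t : A t -> ind A t = 1.
Proof. by move=> /asboolT h; rewrite /ind h. Qed.

Lemma indF (A : set R) t : ~ A t -> ind A t = 0.
Proof. by move=> /asboolF h; rewrite /ind h. Qed.

Lemma small_cvg (F : nat -> set (measurableTypeR R)) :
  (forall n, measurable (F n)) -> F 0%N `<=` @circ R ->
  (forall n, F n.+1 `<=` F n) -> mu (\bigcap_n F n) = 0%E ->
  forall e : R, 0 < e -> exists n, small e (F n).
Proof.
move=> mF F0 dF F_0 e e0.
have circ_itv : @circ R `<=` `[0, 2 * pi]%classic.
  by move=> t /andP[t0 t2]; rewrite /= in_itv/= t0/= ltW.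
have F0oo : (mu (F 0%N) < +oo)%E.
  apply: (@le_lt_trans _ _ (mu `[0, 2 * pi]%classic)).
    apply: le_measure; rewrite ?inE//.
    exact: subset_trans circ_itv.
  by rewrite lebesgue_measure_itv/=; case: ifP => _; rewrite ?ltry.
have h := nonincreasing_cvg_mu (mu := mu) F0oo mF (bigcap_measurable (ex_intro _ 0%N I) (fun k _ => mF k)).
have {}h := h _; have {h} : mu (F n) @[n --> \oo] --> 0%E.
  rewrite -F_0; apply: h; apply/nonincreasing_seqP => n; apply/subsetPset; exact: dF.
move=> /fine_cvgP[fF /cvgr0_norm_le/(_ e e0)] eF.
have [n [fn en]] : exists n, (mu (F n) \is a fin_num) /\ `|fine (mu (F n))| <= e.
  have [n _ H] := filterI fF eF; exists n; exact: (H n (leqnn n)).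
exists n; exists (F n) => //; split => //.
by rewrite -(fineK fn) lee_fin (le_trans (ler_norm _)).
Qed.

(** Stability under sums, products and limits in measure makes the measurable sets with approximable
    indicator a sigma-algebra; it contains the rays []-oo, b[], which generate. *)
Lemma circle_approx_measurable (A : set (measurableTypeR R)) :
  measurable A -> circle_approx (ind A).
Proof.

move: A; suff H : @measurable _ (measurableTypeR R) `<=`
    [set A | @measurable _ (measurableTypeR R) A /\ circle_approx (ind A)].
  by move=> A /H[].
have E : @measurable _ (measurableTypeR R) =
    (@measurable_realfun.RGenInftyO.G R).-sigma.-measurable.
  exact: measurable_realfun.RGenInftyO.measurableE.
rewrite {1}E; apply: smallest_sub => {E}.
  split.
  - split; first exact: measurable0.
    apply: circle_approx_ext (circle_approx_cst 0) => t _.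
    by rewrite indF.
  - move=> A [mA HA]; rewrite setTD; split; first exact: measurableC.
    have H := circle_approxD (circle_approx_cst 1)
      (circle_approxM (circle_approx_cst (-1)) HA).
    apply: circle_approx_ext H => t _.
    have [At|At] := pselect (A t).
      by rewrite (indT At) indF ?mulr1 ?subrr// => /(_ At).
    by rewrite (indF At) indT// mulr0 addr0.
  - move=> A HA; have mA n : @measurable _ (measurableTypeR R) (A n) by case: (HA n).
    split; first exact: bigcupT_measurable.
    pose B n : set (measurableTypeR R) := \big[setU/set0]_(i < n) A i.
    have mB n : measurable (B n) by apply: bigsetU_measurable.
    have HB n : circle_approx (ind (B n)).
      elim: n => [|n IH].
        apply: circle_approx_ext (circle_approx_cst 0) => t _.
        by rewrite indF// /B big_ord0.
      (* The indicator of a union is the sum of the indicators minus their product. *)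
      have H := circle_approxD (circle_approxD IH (HA n).2)
        (circle_approxM (circle_approx_cst (-1)) (circle_approxM IH (HA n).2)).
      apply: circle_approx_ext H => t _.
      rewrite /B big_ord_recr/= -/(B n).
      have [Bt|Bt] := pselect (B n t); have [At|At] := pselect (A n t).
      + by rewrite !indT ?mulr1 ?addrK//; left.
      + by rewrite (indT Bt) (indF At) indT ?mulr0 ?addr0//; left.
      + by rewrite (indF Bt) (indT At) indT ?mul0r ?mulr0 ?add0r ?addr0//; right.
      + by rewrite (indF Bt) (indF At) indF ?mulr0 ?addr0//; case.
    apply: circle_approx_lim => e e0.
    pose F n : set (measurableTypeR R) := (\bigcup_k A k `\` B n) `&` @circ R.
    have mcirc : @measurable _ (measurableTypeR R) (@circ R).
      suff -> : @circ R = `[0, 2 * pi[%classic by exact: measurable_itv.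
      by apply/seteqP; split => t; rewrite /= in_itv.
    have [n sn] : exists n, small e (F n).
      apply: small_cvg => //.
      - move=> n; apply: measurableI => //; apply: measurableD => //.
        exact: bigcupT_measurable.
      - by move=> t [].
      - move=> n t [[At Bt] ct]; split => //; split => // Bn; apply: Bt.
        by rewrite /B big_ord_recr/=; left.
      - suff -> : \bigcap_n F n = set0 by rewrite measure0.
        apply/seteqP; split => // t Ft.
        have [[[k _ Ak] _] _] := Ft 0%N I.
        have [[_ Bk] _] := Ft k.+1 I; apply: Bk.
        by rewrite /B big_ord_recr/=; right.
    exists (ind (B n)) => //; apply: small_sub (lexx e) sn => t [ct tp].
    apply: contrapT => nF; apply: tp.
    have [Bt|Bt] := pselect (B n t).
      rewrite !indT ?subrr ?nm0 ?ltW//.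
      by move: Bt; rewrite /B -bigcup_mkord => -[i _ Ai]; exists i.
    rewrite !indF ?subrr ?nm0 ?ltW// => At; apply: nF; split => //.
move=> _ [b ->]; split; first exact: measurable_itv.
have E : ind `]-oo, b[%classic = (fun t => RtoC ((t < b)%R%:R)).
  apply/funext => t; rewrite /ind; congr (RtoC (nat_of_bool _)%:R).
  by apply/asboolP/idP; rewrite /= in_itv.
rewrite E; have [b0|b0] := lerP b 0.
  apply: circle_approx_ext (circle_approx_cst 0) => t /andP[t0 _].
  by rewrite ltNge (le_trans b0).
have [b2|b2] := ltrP b (2 * pi); first by apply: circle_approx_lt; rewrite b0.
apply: circle_approx_ext (circle_approx_cst 1) => t /andP[_ t2].
by rewrite (lt_le_trans t2).
Qed.

Lemma circle_approx_ind (A : set R) : lebesgue_measurable A -> circle_approx (ind A).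
Proof.
move=> [B mB AB]; apply: circle_approx_ae (circle_approx_measurable mB) _.
apply: small_sub (lexx 0) (small_negligible AB) => t [_ /eqP BA].
apply: contrapT => /not_orP[/= /not_andP h1 /not_andP h2]; apply: BA.
have [At|At] := pselect (A t); have [Bt|Bt] := pselect (B t).
- by rewrite !indT.
- by case: h1.
- by case: h2.
- by rewrite !indF.
Qed.

(** As [h] is finite everywhere, [|h| >= n] holds only on a small part of [circ] for large [n];
    elsewhere a step function of mesh [e] is close to [h]. *)
Lemma circle_approx_rfun (h : R -> R) :
  (forall B : set R, measurable B -> lebesgue_measurable (@circ R `&` h @^-1` B)) ->
  circle_approx (fun t => RtoC (h t)).
Proof.
move=> mh.
pose D n : set R := [set t | circ t /\ n%:R <= `|h t|].
have mD n : lebesgue_measurable (D n).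
  suff -> : D n = @circ R `&` h @^-1` (~` `]- n%:R, n%:R[%classic).
    by apply: mh; apply: measurableC; exact: measurable_itv.
  by apply/seteqP; split => t [ct /= h1]; split => //=; move: h1;
    rewrite in_itv/= -ltr_norml leNgt => /negP.
(* [D n] is only Lebesgue measurable; [B n] is a Borel set equal to it off a null set. *)
have /boolp.choice[B HB] : forall n, exists Bn : set (measurableTypeR R),
    measurable Bn /\ mu.-negligible ((D n `\` Bn) `|` (Bn `\` D n)).
  by move=> n; have [Bn mBn nBn] := mD n; exists Bn.
have mB n := (HB n).1.
have nBD := negligible_bigcup (fun n => (HB n).2).
set N := \bigcup_k _ in nBD.
have BD n t : ~ N t -> (B n t <-> D n t).
  move=> Nt; have nt : ~ ((D n `\` B n) `|` (B n `\` D n)) t by move=> H; apply: Nt; exists n.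
  by split => h1; apply: contrapT => h2; apply: nt; [right|left].
(* Intersecting over [k <= n] restores the monotonicity that the sets [B k] may lack. *)
pose F n : set (measurableTypeR R) := @circ R `&` \bigcap_(k in [set k | (k <= n)%N]) B k.
have mcirc : @measurable _ (measurableTypeR R) (@circ R).
  suff -> : @circ R = `[0, 2 * pi[%classic by exact: measurable_itv.
  by apply/seteqP; split => t; rewrite /= in_itv.
have mF n : measurable (F n).
  by apply: measurableI => //; apply: bigcap_measurable => //; exists 0%N.
have smallF : forall e : R, 0 < e -> exists n, small e (F n).
  apply: small_cvg => //; first by move=> t [].
    by move=> n t [ct Bt]; split => // k kn; apply: Bt; exact: leqW.
  apply: measure_negligible.
    by apply: bigcap_measurable => //; exists 0%N.
  apply: negligibleS nBD => t Ft; apply: contrapT => Nt.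
  have [ct Bt] := Ft (Num.bound `|h t|) I.
  have /(BD _ _ Nt)[_] := Bt _ (leqnn _).
  by rewrite leNgt archi_boundP.
apply: circle_approx_lim => e e0.
have [n Fn] := smallF e e0.
(* Levels of mesh [e] starting at [-n]; [M] of them reach [n]. *)
pose c j : R := j%:R * e - n%:R.
pose A j : set R := [set t | circ t /\ c j <= h t < c j.+1].
pose M := Num.bound (2 * n%:R / e).
exists (fun t => \sum_(j < M) RtoC (c j) * ind (A j) t).
  apply: (@circle_approx_sum M (fun j t => RtoC (c j) * ind (A j) t)) => j.
  apply: circle_approxM; first exact: circle_approx_cst.
  apply: circle_approx_ind.
  suff -> : A j = @circ R `&` h @^-1` `[c j, c j.+1[%classic.
    by apply: mh; exact: measurable_itv.
  by apply/seteqP; split => t [ct /= h1]; split => //=; move: h1; rewrite in_itv.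
apply: small_sub (smallU Fn (small_negligible nBD)); last by rewrite addr0.
move=> t [ct tp]; apply: contrapT => /not_orP[nF Nt]; apply: tp.
have hn : `|h t| < n%:R.
  rewrite ltNge; apply/negP => nh; apply: nF; split => // k /= kn; apply/BD => //.
  by split => //; rewrite (le_trans _ nh)// ler_nat.
pose x := (h t + n%:R) / e.
move: hn; rewrite ltr_norml => /andP[hn1 hn2].
have x0 : 0 <= x by rewrite divr_ge0 ?ltW//; lra.
have xM : x < M%:R.
  have : 2 * n%:R / e < M%:R by apply: archi_boundP; rewrite divr_ge0 ?mulr_ge0// ltW.
  by apply: le_lt_trans; rewrite ler_pM2r ?invr_gt0//; lra.
have cx j : (c j <= h t < c j.+1) = (j%:R <= x < j.+1%:R).
  by rewrite /c /x lerBlDr ltrBrDr ler_pdivlMr// ltr_pdivrMr.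
have /andP[k1 k2] := truncn_itv x0.
set k := Num.trunc x in k1 k2.
have kM : (k < M)%N by rewrite -(ltr_nat R) (le_lt_trans k1).
rewrite (bigD1 (Ordinal kM))//= big1 ?addr0; last first.
  move=> j jk; rewrite indF ?mulr0// => -[_]; rewrite cx => /truncn_def kj.
  by move/eqP: jk; apply; apply: val_inj; rewrite /= -kj.
rewrite indT ?mulr1; last by split => //; rewrite cx k1.
rewrite -RtoCB nm_RtoC.
have := cx k; rewrite k1 k2 => /andP[]; rewrite /c -natr1 => h1 h2.
rewrite ler0_norm; lra.
Qed.

End CircleApprox.

(** * Polynomials approximating along radii *)

Section Step.
Variable R : realType.
Local Notation C := (Cplx R).

Lemma lipschitz_horner (p : {poly C}) : exists2 L : R, 0 <= L &
  forall x y : C, nm x <= 1 -> nm y <= 1 -> nm (p.[x] - p.[y]) <= L * nm (x - y).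
Proof.
elim/poly_ind: p => [|p c [L L0 IH]].
  by exists 0 => // x y _ _; rewrite !horner0 subrr nm0 mul0r.
exists (cn 1 p + L) => [|x y x1 y1]; first by rewrite addr_ge0// cn_ge0.
rewrite !hornerD !hornerM !hornerX !hornerC opprD addrACA subrr addr0 (le_trans (nm_subM _ _ _ _))//.
rewrite mulrDl lerD ?ler_wpM2r ?nm_ge0 ?nm_horner//.
by rewrite -[leRHS]mulr1 ler_pM ?nm_ge0 ?IH.
Qed.

(* One correction step: [F' = F + (1 - G (z ^ N)) (q - F)] with [q] close to [Psi] on
   the circle and [G] a peak polynomial.  For large [N] the factor [1 - G (z ^ N)] is
   tiny on the disk of radius [r], while along the good radii it is bounded by a
   constant [K] that depends on [d] only. *)
Lemma correction_step (d : R) : 0 < d -> exists2 K : R, 0 < K &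
  forall (F : {poly C}) (Psi : R -> C) (E0 : set R) (e r e' : R),
  circle_approx Psi -> 0 <= e -> 0 < e' -> 0 <= r < 1 ->
  (forall t, circ t -> ~ E0 t -> nm (F.[expi t] - Psi t) <= e) ->
  exists (F' : {poly C}) (E : set R), [/\ small d E, cn r (F' - F) <= e',
    forall t, circ t -> ~ E t -> nm (F'.[expi t] - Psi t) <= e' &
    forall t rho, circ t -> ~ E0 t -> ~ E t -> 0 <= rho <= 1 ->
      nm (F' - F).[RtoC rho * expi t] <= K * (e + e')].
Proof.
move=> d0; have d20 : 0 < d / 2 by rewrite divr_gt0.
have [s s01 gap] := slit_gap d20; have /andP[s0 s1] := s01.
have K00 : 0 < s^-1 + 1 by rewrite addr_gt0// invr_gt0.
exists (1 + (s^-1 + 1)); first by rewrite addr_gt0.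
move=> F Psi E0 e r e' HPsi e0 e'0 /andP[r0 r1] HF.
pose a := Num.min (d / 2) (e' / 2).
have a0 : 0 < a by rewrite /a lt_min d20 divr_gt0.
have ad : a <= d / 2 by rewrite /a ge_min lexx.
have ae : a <= e' / 2 by rewrite /a ge_min lexx orbT.
have [q Hq] := HPsi a a0.
pose H := q - F.
have [L L0 HL] := lipschitz_horner H.
(* Between modulus [r'] and the circle, [H] varies by at most [e' / 2] on each radius. *)
pose r' := Num.max r (1 - e' / 2 / (L + 1)).
have L1 : 0 < L + 1 by rewrite ltr_wpDl.
have r'0 : 0 <= r' by rewrite /r' le_max r0.
have rr' : r <= r' by rewrite /r' le_max lexx.
have r'1 : r' < 1 by rewrite /r' gt_max r1/= ltrBlDr ltrDl !divr_gt0.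
have cH0 : 0 <= cn 1 H by apply: cn_ge0.
have HH t rho : r' <= rho -> rho <= 1 ->
    nm (H.[RtoC rho * expi t]) <= nm (H.[expi t]) + e' / 2.
  move=> r'rho rho1; have rho0 : 0 <= rho by rewrite (le_trans r'0).
  rewrite -[H.[_ * _]](subrK H.[expi t]) (le_trans (nmD _ _))// addrC lerD2l.
  apply: (le_trans (HL _ _ _ _)).
  - by rewrite nmM nm_RtoC nm_expi mulr1 ger0_norm.
  - by rewrite nm_expi.
  - have -> : RtoC rho * expi t - expi t = RtoC (rho - 1) * expi t :> C.
      by rewrite RtoCB mulrBl; congr (_ - _); rewrite mul1r.
    rewrite nmM nm_RtoC nm_expi mulr1 ler0_norm ?subr_le0// opprB.
    apply: (@le_trans _ _ ((L + 1) * (e' / 2 / (L + 1)))); last first.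
      by rewrite mulrC divfK// gt_eqF.
    rewrite ler_pM ?subr_ge0// ?lerDl//.
    by move: r'rho; rewrite /r' ge_max => /andP[_]; lra.
(* With this accuracy the product of [G(z^n)] and [H] is at most [e' / 2] on the good part of the
   circle. *)
have [G [G0 Gs Ge]] : exists G : {poly C}, [/\ G.[0] = 1,
    forall z, slit_disk s z -> nm G.[z] <= s^-1 + 1 &
    forall z, slit_disk s z -> nm z = 1 -> nm G.[z] <= e' / 2 / (cn 1 H + 1)].
  by apply: peak_poly => //; rewrite !divr_gt0// ltr_wpDl.
have /factor_theorem[P PG] : root (1 - G) 0 by rewrite rootE !hornerE G0 subrr.
have [B B0 HB] := cn_compXn P.
have [N] : exists N, forall n, (N <= n)%N -> r' ^+ n <= e' / (B * cn 1 H + 1).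
  apply: pow_small; first by rewrite r'0.
  by rewrite divr_gt0// ltr_wpDl// mulr_ge0.
(* The successor makes the exponent positive, as [slit_gap] requires. *)
move=> /(_ N.+1 (leqnSn _)) HN; set n := N.+1 in HN.
have n0 : (0 < n)%N by [].
pose chi := (P \Po 'X^n) * 'X^n.
have chiE z : chi.[z] = 1 - G.[z ^+ n].
  have : (1 - G).[z ^+ n] = P.[z ^+ n] * z ^+ n.
    by rewrite PG hornerM hornerXsubC subr0.
  by rewrite /chi hornerM horner_comp !hornerXn => <-; rewrite !hornerE.
have cnchi : cn r' (chi * H) <= e'.
  apply: (le_trans (cnM _ _ r'0)).
  apply: (@le_trans _ _ (B * r' ^+ n * cn 1 H)).
    rewrite ler_pM ?cn_ge0//; last by rewrite cn_le// ltW.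
    rewrite (le_trans (cnM _ _ r'0))// cnXn ler_wpM2r ?exprn_ge0//.
    by apply: HB; rewrite r'0 ltW.
  rewrite mulrAC; apply: (@le_trans _ _ ((B * cn 1 H + 1) * (e' / (B * cn 1 H + 1)))).
    by rewrite ler_pM ?mulr_ge0 ?exprn_ge0// lerDl.
  by rewrite mulrC divfK// gt_eqF// ltr_wpDl// mulr_ge0.
have e_chi : F + chi * H - F = chi * H by rewrite addrC addKr.
exists (F + chi * H), ([set t | circ t /\
  ~ (forall rho : R, 0 <= rho <= 1 -> slit_disk s ((RtoC rho * expi t : C) ^+ n))] `|`
  [set t | circ t /\ ~ (nm (q.[expi t] - Psi t) <= a)]); split.
- apply: small_sub (smallU (gap n n0) Hq) => //.
  by rewrite [leRHS](Num.Theory.splitr d) lerD.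
- by rewrite e_chi (le_trans _ cnchi)// cn_le.
- move=> t ct /not_orP[/not_andP[//|/contrapT slit] /not_andP[//|/contrapT qa]].
  have GE : nm G.[expi t ^+ n] <= e' / 2 / (cn 1 H + 1).
    apply: Ge; last by rewrite nmX nm_expi expr1n.
    have one01 : 0 <= (1 : R) <= 1 by apply/andP.
    by have := slit 1 one01; have -> : RtoC 1 = 1 :> C by []; rewrite mul1r.
  have -> : (F + chi * H).[expi t] - Psi t =
      (q.[expi t] - Psi t) - G.[expi t ^+ n] * H.[expi t].
    by rewrite hornerD hornerM chiE /H hornerD hornerN; ring.
  rewrite [leRHS](Num.Theory.splitr e') (le_trans (nmD _ _))// nmN lerD//.
    exact: le_trans ae.
  rewrite nmM; apply: (@le_trans _ _ (e' / 2 / (cn 1 H + 1) * (cn 1 H + 1))).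
    rewrite ler_pM ?nm_ge0// (le_trans (nm_horner (r := 1) _ _)) ?nm_expi//.
    by rewrite lerDl.
  by rewrite divfK// gt_eqF// ltr_wpDl.
- move=> t rho ct /(HF t ct) HFt.
  move=> /not_orP[/not_andP[//|/contrapT slit] /not_andP[//|/contrapT qa]].
  move=> rho01; have /andP[rho0 rho1] := rho01; rewrite e_chi.
  have ee : 0 <= e + e' by rewrite addr_ge0 // ltW.
  have nz : nm (RtoC rho * expi t : C) = rho.
    by rewrite nmM nm_RtoC nm_expi mulr1 ger0_norm.
  (* Up to [r'] the coefficient norm bounds the correction by [e']. Beyond, the modulus of [H]
     exceeds its boundary value, at most [e + e' / 2], by at most [e' / 2]. *)
  have [rr|rr] := lerP rho r'.
    apply: le_trans (nm_horner (r := r') _ _) _; first by rewrite nz.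
    apply: (le_trans cnchi); apply: (@le_trans _ _ (1 * (e + e'))).
      by rewrite mul1r lerDr.
    by rewrite ler_wpM2r// lerDl ltW.
  rewrite hornerM nmM ler_pM ?nm_ge0//.
    rewrite chiE (le_trans (nmD _ _))// nm1 nmN lerD2l.
    by apply: Gs; apply: slit.
  apply: (le_trans (HH t rho (ltW rr) rho1)).
  have h1 : nm H.[expi t] <= nm (q.[expi t] - Psi t) + nm (F.[expi t] - Psi t).
    by rewrite /H hornerD hornerN [X in _ <= _ + X]nmB nm_triangle.
  by move: h1 HFt qa ae; lra.
Qed.

Definition hpow n : R := 2^-1 ^+ n.

Lemma hpow_gt0 n : 0 < hpow n.
Proof. by rewrite exprn_gt0// invr_gt0. Qed.

Lemma hpowS n : hpow n = hpow n.+1 + hpow n.+1.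
Proof. by rewrite /hpow exprS; lra. Qed.

Lemma hpow_le1 n : hpow n <= 1.
Proof. by rewrite exprn_ile1// ?invr_ge0// invf_le1// ler1n. Qed.

(** The constants [K n] depend only on the sizes [hpow n] of the exceptional sets, so they come
    first and the tolerances [e n] are chosen to absorb them. *)
Lemma approx_sequence (Psi : R -> C) : circle_approx Psi ->
  exists (F : nat -> {poly C}) (E : nat -> set R), [/\
    forall n, small (hpow n.+1) (E n.+1),
    forall n, cn (1 - hpow n.+1) (F n.+1 - F n) <= hpow n,
    forall n t, circ t -> ~ E n.+1 t -> nm ((F n.+1).[expi t] - Psi t) <= hpow n &
    forall n t rho, circ t -> ~ E n t -> ~ E n.+1 t -> 0 <= rho <= 1 ->
      nm (F n.+1 - F n).[RtoC rho * expi t] <= hpow n].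
Proof.
move=> HPsi.
have /boolp.choice[K HK] : forall n, exists K : R, 0 < K /\
    forall (F : {poly C}) (Psi : R -> C) (E0 : set R) (e r e' : R),
  circle_approx Psi -> 0 <= e -> 0 < e' -> 0 <= r < 1 ->
  (forall t, circ t -> ~ E0 t -> nm (F.[expi t] - Psi t) <= e) ->
  exists (F' : {poly C}) (E : set R), [/\ small (hpow n) E, cn r (F' - F) <= e',
    forall t, circ t -> ~ E t -> nm (F'.[expi t] - Psi t) <= e' &
    forall t rho, circ t -> ~ E0 t -> ~ E t -> 0 <= rho <= 1 ->
      nm (F' - F).[RtoC rho * expi t] <= K * (e + e')].
  by move=> n; have [K K0 H] := correction_step (hpow_gt0 n); exists K.
have K0 n : 0 < K n := (HK n).1.
(* [e n] meets [K n] as the new tolerance of one step and [K n.+1] as the old one of the next, hence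
   the sum in the denominator. *)
pose e n := Num.min (hpow n) (hpow n / 2 / (K n + K n.+1)).
have e_gt0 n : 0 < e n.
  by rewrite /e lt_min hpow_gt0 !divr_gt0 ?hpow_gt0// addr_gt0.
have e_hpow n : e n <= hpow n by rewrite /e ge_min lexx.
have Ke n : K n.+1 * (e n + e n.+1) <= hpow n.
  have h1 : K n.+1 * e n <= hpow n / 2.
    apply: (@le_trans _ _ ((K n + K n.+1) * (hpow n / 2 / (K n + K n.+1)))).
      rewrite ler_pM ?(ltW (K0 _)) ?(ltW (e_gt0 _))//; first by rewrite lerDr ltW.
      by rewrite /e ge_min lexx orbT.
    by rewrite mulrC divfK// gt_eqF// addr_gt0.
  have h2 : K n.+1 * e n.+1 <= hpow n.+1 / 2.
    apply: (@le_trans _ _ ((K n.+1 + K n.+2) * (hpow n.+1 / 2 / (K n.+1 + K n.+2)))).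
      rewrite ler_pM ?(ltW (K0 _)) ?(ltW (e_gt0 _))//; first by rewrite lerDl ltW.
      by rewrite /e ge_min lexx orbT.
    by rewrite mulrC divfK// gt_eqF// addr_gt0.
  rewrite mulrDr; have := hpowS n; have := hpow_gt0 n.+1; lra.
pose good n (s : {poly C} * set R) :=
  forall t, circ t -> ~ s.2 t -> nm (s.1.[expi t] - Psi t) <= e n.
pose rel n (s s' : {poly C} * set R) := [/\ small (hpow n.+1) s'.2,
  cn (1 - hpow n.+1) (s'.1 - s.1) <= hpow n.+1 &
  forall t rho, circ t -> ~ s.2 t -> ~ s'.2 t -> 0 <= rho <= 1 ->
      nm (s'.1 - s.1).[RtoC rho * expi t] <= hpow n].
have /boolp.choice[u Hu] : forall ns : nat * ({poly C} * set R),
    exists s', good ns.1 ns.2 -> good ns.1.+1 s' /\ rel ns.1 ns.2 s'.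
  move=> [n s] /=; have [gs|ngs] := pselect (good n s); last by exists s.
  have r01 : 0 <= 1 - hpow n.+1 < 1.
    by rewrite subr_ge0 hpow_le1 ltrBlDr ltrDl hpow_gt0.
  have [F' [E [h1 h2 h3 h4]]] :=
    (HK n.+1).2 s.1 Psi s.2 _ _ _ HPsi (ltW (e_gt0 n)) (e_gt0 n.+1) r01 gs.
  exists (F', E) => _; split => //; split => //=; first exact: le_trans h2 _.
  by move=> t rho ct Et E't rho01; apply: le_trans (Ke n); exact: h4.
(* The start is the zero polynomial with every angle exceptional, so that [good 0] holds
   vacuously. *)
pose s := nat_rect (fun=> ({poly C} * set R)%type) (0, setT) (fun n s => u (n, s)).
have Hs n : good n (s n).
  elim: n => [|n IH]; first by move=> t _ /=.
  by have [] := Hu (n, s n) IH.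
exists (fun n => (s n).1), (fun n => (s n).2).
have rels n : rel n (s n) (s n.+1) by have [] := Hu (n, s n) (Hs n).
have hpow_le n : hpow n.+1 <= hpow n by rewrite [hpow n]hpowS lerDl ltW// hpow_gt0.
split.
- by move=> n; case: (rels n).
- by move=> n; case: (rels n) => _ h _; apply: le_trans h _.
- by move=> n t ct nE; rewrite (le_trans (Hs n.+1 t ct nE))// (le_trans (e_hpow _)).
- by move=> n; case: (rels n).
Qed.

Lemma geometric_limit_real (u : nat -> R) (c : R) N :
  (forall n, (N <= n)%N -> `|u n.+1 - u n| <= c * hpow n) ->
  exists l, forall n, (N <= n)%N -> `|u n - l| <= 2 * c * hpow n.
Proof.
move=> H.
have c0 : 0 <= c.
  have := le_trans (normr_ge0 _) (H N (leqnn N)).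
  by rewrite pmulr_lge0// hpow_gt0.
(* The telescoped bound [hpow n - hpow (n + k)], rather than [hpow n], lets the induction on [k]
   close. *)
have lo n k : (N <= n)%N -> `|u (n + k)%N - u n| <= 2 * c * (hpow n - hpow (n + k)).
  move=> Nn; elim: k => [|k IH]; first by rewrite addn0 !subrr normr0 mulr0.
  rewrite addnS; have := H (n + k)%N (leq_trans Nn (leq_addr _ _)).
  have := hpowS (n + k) => h1 h2.
  have -> : u (n + k).+1 - u n = (u (n + k).+1 - u (n + k)%N) + (u (n + k)%N - u n) by ring.
  rewrite (le_trans (ler_normD _ _))//.
  have -> : 2 * c * (hpow n - hpow (n + k).+1) = c * hpow (n + k) +
    2 * c * (hpow n - hpow (n + k)) by rewrite h1; ring.
  exact: lerD.
have bnd n m : (N <= n)%N -> (N <= m)%N -> u m <= u n + 2 * c * hpow n + 2 * c * hpow m.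
  move=> Nn Nm; have c2 k : 0 <= 2 * c * hpow k by rewrite !mulr_ge0// ltW// hpow_gt0.
  have [nm|mn] := leqP n m.
    have := lo n (m - n)%N Nn; rewrite subnKC// ler_norml => /andP[_].
    rewrite mulrBr; have := c2 m; lra.
  have := lo m (n - m)%N Nm; rewrite subnKC ?(ltnW mn)// ler_norml => /andP[+ _].
  rewrite mulrBr; have := c2 n; lra.
(* Completeness enters here: each lower barrier [u n - 2 * c * hpow n] lies below every upper one,
   and the limit is their supremum. *)
pose A := [set x | exists2 n, (N <= n)%N & x = u n - 2 * c * hpow n].
have ubA n : (N <= n)%N -> ubound A (u n + 2 * c * hpow n).
  by move=> Nn _ [m Nm ->]; rewrite lerBlDr; exact: bnd.
exists (sup A) => n Nn; rewrite ler_distlC; apply/andP; split.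
  apply: sup_upper_bound; last by exists n.
  by split; [exists (u n - 2 * c * hpow n); exists n|exists (u n + 2 * c * hpow n); exact: ubA].
apply: sup_le_ub; last exact: ubA.
by exists (u n - 2 * c * hpow n); exists n.
Qed.

Lemma geometric_limit (u : nat -> C) (c : R) N :
  (forall n, (N <= n)%N -> nm (u n.+1 - u n) <= c * hpow n) ->
  exists l, forall n, (N <= n)%N -> nm (u n - l) <= 4 * c * hpow n.
Proof.
move=> H.
have ReB (x y : C) : complex.Re (x - y) = complex.Re x - complex.Re y by case: x y => ? ? [].
have ImB (x y : C) : complex.Im (x - y) = complex.Im x - complex.Im y by case: x y => ? ? [].
have [|a Ha] := @geometric_limit_real (fun n => complex.Re (u n)) c N.
  by move=> n Nn; rewrite -ReB (le_trans (Re_nm _))// H.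
have [|b Hb] := @geometric_limit_real (fun n => complex.Im (u n)) c N.
  by move=> n Nn; rewrite -ImB (le_trans (Im_nm _))// H.
exists (Complex a b) => n Nn; rewrite (le_trans (nm_ReIm _))// ReB ImB /=.
have -> : 4 * c * hpow n = 2 * c * hpow n + 2 * c * hpow n by ring.
by rewrite lerD ?Ha ?Hb.
Qed.

End Step.

(** * The limit of the polynomials: holomorphy and radial limits *)

Section DiskFunction.
Variable R : realType.
Local Notation C := (Cplx R).
Local Notation mu := (@lebesgue_measure R).

Definition tends (u : nat -> C) (l : C) := forall e : R, 0 < e ->
  exists N, forall n, (N <= n)%N -> nm (u n - l) <= e.

Lemma hpow_small (c e : R) : 0 <= c -> 0 < e ->
  exists N, forall n, (N <= n)%N -> c * hpow R n <= e.
Proof.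
move=> c0 e0; have c1 : 0 < c + 1 by rewrite ltr_wpDl.
have [||N HN] := @pow_small R 2^-1 (e / (c + 1)).
- by rewrite invr_ge0 ler0n/= invf_lt1// ltr1n.
- by rewrite divr_gt0.
exists N => n /HN h; apply: (@le_trans _ _ ((c + 1) * (e / (c + 1)))).
  by rewrite ler_pM ?(ltW (hpow_gt0 _ _))// lerDl.
by rewrite mulrC divfK// gt_eqF.
Qed.

Lemma tends_geometric (u : nat -> C) (c : R) N : 0 <= c ->
  (forall n, (N <= n)%N -> nm (u n.+1 - u n) <= c * hpow R n) -> exists l, tends u l.
Proof.
move=> c0 /geometric_limit[l Hl]; exists l => e e0.
have [|M HM] := @hpow_small (4 * c) e _ e0; first by rewrite mulr_ge0.
exists (maxn N M) => n; rewrite geq_max => /andP[Nn Mn].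
exact: le_trans (Hl n Nn) (HM n Mn).
Qed.

Lemma tends_unique (u : nat -> C) l l' : tends u l -> tends u l' -> l = l'.
Proof.
move=> Hl Hl'; apply/eqP; rewrite -subr_eq0 -nm_eq0 eq_le nm_ge0 andbT.
apply/ler_addgt0Pr => e e0; rewrite add0r.
have e20 : 0 < e / 2 by rewrite divr_gt0.
have [N HN] := Hl _ e20; have [M HM] := Hl' _ e20.
rewrite (le_trans (nm_triangle (u (maxn N M)) _ _))// [leRHS](Num.Theory.splitr e).
by rewrite lerD ?HM ?leq_maxr// nmB HN ?leq_maxl.
Qed.

Lemma tends_geometric_rate (u : nat -> C) l (c : R) N : 0 <= c -> tends u l ->
  (forall n, (N <= n)%N -> nm (u n.+1 - u n) <= c * hpow R n) ->
  forall n, (N <= n)%N -> nm (u n - l) <= 4 * c * hpow R n.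
Proof.
move=> c0 ul H; have [l' Hl'] := geometric_limit H.
suff -> : l = l' by [].
apply: tends_unique ul _ => e e0.
have [|M HM] := @hpow_small (4 * c) e _ e0; first by rewrite mulr_ge0.
exists (maxn N M) => n; rewrite geq_max => /andP[Nn Mn].
exact: le_trans (Hl' n Nn) (HM n Mn).
Qed.

Lemma negligible_limsup (E : nat -> set R) : (forall n, small (hpow R n.+1) (E n)) ->
  exists2 Z : set R, mu.-negligible Z &
    forall t, ~ Z t -> exists N, forall n, (N <= n)%N -> ~ E n t.
Proof.
move=> sE.
have /boolp.choice[B HB] : forall n, exists B : set (measurableTypeR R),
  [/\ measurable B, E n `<=` B & (mu B <= (hpow R n.+1)%:E)%E].
  by move=> n; have [B mB [EB Bh]] := sE n; exists B.
exists (lim_sup_set B).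
  exists (lim_sup_set B); split => //.
    apply: bigcap_measurable; first by exists 0%N.
    by move=> n _; apply: bigcup_measurable => k _; case: (HB k).
  apply: lim_sup_set_cvg0; first by move=> n; case: (HB n).
  apply: (@le_lt_trans _ _ (\sum_(0 <= n <oo) (hpow R n.+1)%:E)%E).
    apply: lee_nneseries => //= n _; by case: (HB n).
  apply: (@le_lt_trans _ _ 1%:E); last exact: ltry.
  apply: lime_le.
    by apply: is_cvg_nneseries => n _ _; rewrite lee_fin ltW// hpow_gt0.
  apply: nearW => n; rewrite sumEFin lee_fin.
  suff -> : \sum_(0 <= i < n) hpow R i.+1 = 1 - hpow R n.
    by rewrite gerBl ltW// hpow_gt0.
  elim: n => [|n IH]; first by rewrite big_nil /hpow expr0 subrr.
  by rewrite big_nat_recr//= IH (hpowS R n); ring.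
move=> t /existsNP[N /not_implyP[_ HN]]; exists N => n Nn En; apply: HN.
by exists n => //; have [_ EB _] := HB n; exact: EB.
Qed.

Lemma derivable_quadratic (f : C -> C) (z l : C) (c d : R) : 0 < d -> 0 <= c ->
  (forall h : C, nm h < d -> nm (f (z + h) - f z - h * l) <= c * nm h ^+ 2) ->
  derivable f z 1.
Proof.
move=> d0 c0 H; rewrite /derivable; apply/cvg_ex; exists l.
apply/cvg_nm => e e0.
have c1 : 0 < c + 1 by rewrite ltr_wpDl.
apply/nbhs_nm; exists (Num.min d (e / (c + 1))).
  by rewrite lt_min d0 divr_gt0.
move=> h; rewrite subr0 lt_min => /andP[hd he] h0.
have hn0 : 0 < nm h by rewrite nm_gt0.
have -> : h^-1 *: (f (h *: 1 + z) - f z) - l = h^-1 * (f (z + h) - f z - h * l).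
  have -> : h *: 1 + z = z + h :> C by rewrite addrC; congr (_ + _); exact: mulr1.
  by rewrite mulrBr mulKf.
rewrite nmM nmV mulrC ltr_pdivrMr// (le_lt_trans (H h hd))//.
rewrite expr2 mulrA ltr_pM2r// (@le_lt_trans _ _ ((c + 1) * nm h))//.
  by rewrite ler_wpM2r ?nm_ge0// lerDl.
by rewrite mulrC -ltr_pdivlMr.
Qed.

(** Taylor remainders of the polynomials pass to the limit with a bound quadratic in [h], whence
    holomorphy. For radial limits, a single polynomial is close to [f] on a whole open radius and to
    [Psi] at its end, and it is continuous there. *)
Lemma disk_function (Psi : R -> C) : circle_approx Psi ->
  exists f : C -> C, (forall z, nm z < 1 -> derivable f z 1) /\
  exists2 Z : set R, mu.-negligible Z & forall t, circ t -> ~ Z t ->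
    forall e : R, 0 < e -> exists2 r0 : R, r0 < 1 &
      forall r, r0 <= r < 1 -> 0 <= r -> nm (f (RtoC r * expi t) - Psi t) <= e.
Proof.
move=> /approx_sequence[F [E [sE cnF EF radF]]].
have tail (r : R) : r < 1 -> exists N, forall n, (N <= n)%N -> r <= 1 - hpow R n.+1.
  move=> r1; have [||N HN] := @hpow_small 1 (1 - r); rewrite ?subr_gt0//.
  exists N => n Nn; have := HN n.+1 (leqW Nn); rewrite mul1r; lra.
have cvF z : nm z < 1 -> exists l, tends (fun n => (F n).[z]) l.
  move=> /tail[N HN]; apply: (@tends_geometric _ 1 N) => // n Nn.
  by rewrite mul1r -hornerN -hornerD (le_trans _ (cnF n))// nm_horner// HN.
have /boolp.choice[f Hf] : forall z, exists l, nm z < 1 -> tends (fun n => (F n).[z]) l.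
  move=> z; have [/cvF[l Hl]|z1] := pselect (nm z < 1); first by exists l.
  by exists 0.
exists f; split.
  move=> z z1; pose s := (1 - nm z) / 3.
  have s0 : 0 < s by rewrite divr_gt0// subr_gt0.
  have zs1 : nm z + s < 1 by rewrite /s; lra.
  have [N HN] := tail _ zs1.
  have cnN n : (N <= n)%N -> cn (nm z + s) (F n.+1 - F n) <= hpow R n.
    move=> Nn; rewrite (le_trans _ (cnF n))// cn_le ?HN//.
    by rewrite addr_ge0 ?nm_ge0// ltW.
  have [l Hl] : exists l, tends (fun n => ((F n)^`()).[z]) l.
    apply: (@tends_geometric _ s^-1 N); first by rewrite invr_ge0 ltW.
    move=> n Nn; rewrite -hornerN -hornerD -derivN -derivD.
    apply: (le_trans (nm_deriv _ _ s0)).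
    by rewrite mulrC ler_wpM2l ?invr_ge0 ?cnN// ltW.
  (* The 4 bounds all corrections after [F N], the other term the remainder of [F N] itself. *)
  pose c := (4 + cn (nm z + s) (F N)) / s ^+ 2.
  have cn0 : 0 <= cn (nm z + s) (F N) by rewrite cn_ge0// addr_ge0 ?nm_ge0// ltW.
  have c0 : 0 <= c by rewrite divr_ge0 ?sqr_ge0// addr_ge0.
  apply: (@derivable_quadratic f z l c s) => // h hs.
  have zh1 : nm (z + h) < 1.
    by rewrite (le_lt_trans (nmD _ _))// (lt_trans _ zs1)// ltrD2l.
  have T n : (N <= n)%N -> nm (taylor2 (F n.+1) z h - taylor2 (F n) z h) <=
      (nm h / s) ^+ 2 * hpow R n.
    move=> Nn.
    have -> : taylor2 (F n.+1) z h - taylor2 (F n) z h = taylor2 (F n.+1 - F n) z h.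
      by rewrite /taylor2 derivD derivN !hornerD !hornerN; ring.
    apply: (le_trans (nm_taylor2 _ _ s0 (ltW hs))).
    by rewrite ler_wpM2l ?sqr_ge0 ?cnN.
  have tT : tends (fun n => taylor2 (F n) z h) (f (z + h) - f z - h * l).
    move=> e e0; have h1 : 0 < nm h + 1 by rewrite ltr_wpDl ?nm_ge0.
    have e3 : 0 < e / 3 by rewrite divr_gt0.
    have eh : 0 < e / 3 / (nm h + 1) by rewrite divr_gt0.
    have [N1 H1] := Hf _ zh1 _ e3; have [N2 H2] := Hf _ z1 _ e3.
    have [N3 H3] := Hl _ eh.
    exists (maxn N1 (maxn N2 N3)) => n; rewrite !geq_max => /and3P[n1 n2 n3].
    have -> : taylor2 (F n) z h - (f (z + h) - f z - h * l) =
      ((F n).[z + h] - f (z + h)) - ((F n).[z] - f z) - h * (((F n)^`()).[z] - l).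
      by rewrite /taylor2; ring.
    have h4 := nmD ((F n).[z + h] - f (z + h) - ((F n).[z] - f z))
      (- (h * (((F n)^`()).[z] - l))).
    have h5 := nmD ((F n).[z + h] - f (z + h)) (- ((F n).[z] - f z)).
    have h6 : nm (h * (((F n)^`()).[z] - l)) <= e / 3.
      rewrite nmM; apply: (@le_trans _ _ ((nm h + 1) * (e / 3 / (nm h + 1)))).
        by rewrite ler_pM ?nm_ge0 ?H3// lerDl.
      by rewrite mulrC divfK// gt_eqF.
    have := H1 n n1; have := H2 n n2; move: h4 h5 h6; rewrite !nmN; lra.
  have hs2 : 0 <= (nm h / s) ^+ 2 by rewrite sqr_ge0.
  have h1 := tends_geometric_rate hs2 tT T (leqnn N).
  have h2 := nm_taylor2 (F N) z s0 (ltW hs).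
  have -> : c * nm h ^+ 2 = (nm h / s) ^+ 2 * (4 + cn (nm z + s) (F N)).
    suff eqn (a x y : R) : a / y ^+ 2 * x ^+ 2 = (x / y) ^+ 2 * a by exact: eqn.
    by rewrite exprMn exprVn; ring.
  rewrite -[_ - h * l](subKr (taylor2 (F N) z h)) (le_trans (nmD _ _))// nmN.
  rewrite mulrDr addrC lerD// (le_trans h1)// [leRHS]mulrC.
  by rewrite -[leRHS]mulr1 ler_wpM2l ?hpow_le1// mulr_ge0.
(* The shift leaves out [E 0], whose size is not controlled. *)
pose E' n := E n.+1; have [Z nZ HZ] := negligible_limsup (E := E') sE.
exists Z => // t ct /HZ[N HN] e e0.
have e20 : 0 < e / 2 by rewrite divr_gt0.
(* Four parts for the distance from [f] to [F n.+1] along the radius, one for that from [F n.+1] to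
   [Psi] at its end. *)
have [M HM] := @hpow_small 5 _ (ler0n _ 5) e20.
(* The bound on step [k] along the radius requires [t] to avoid both [E k] and [E k.+1], that is
   [E'] at [k - 1] and [k]. *)
pose n := maxn N.+1 M.
have Nn : (N.+1 <= n)%N := leq_maxl _ _; have Mn : (M <= n)%N := leq_maxr _ _.
have close (r : R) : 0 <= r < 1 ->
    nm ((F n.+1).[RtoC r * expi t] - f (RtoC r * expi t)) <= 4 * hpow R n.
  move=> /andP[r0 r1].
  have nz : nm (RtoC r * expi t : C) < 1.
    by rewrite nmM nm_RtoC nm_expi mulr1 ger0_norm.
  rewrite -[4]mulr1; apply: le_trans (tends_geometric_rate ler01 (Hf _ nz) (N := N.+1) _ _) _.
  - move=> k Nk; rewrite mul1r -hornerN -hornerD; apply: radF => //.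
    + by case: k Nk => // k Nk; exact: HN.
    + exact: HN (ltnW Nk).
    + by rewrite r0 ltW.
  - exact: leq_trans Nn (leqnSn _).
  - by rewrite ler_wpM2l ?mulr1// (hpowS R n) lerDl ltW// hpow_gt0.
have [L L0 HL] := lipschitz_horner (F n.+1).
have L1 : 0 < L + 1 by rewrite ltr_wpDl.
exists (1 - e / 2 / (L + 1)); first by rewrite ltrBlDr ltrDl !divr_gt0.
move=> r /andP[re r1] r0.
have h1 := close r; rewrite r0 r1 in h1; have {}h1 := h1 isT.
have h2 := EF n t ct (HN n (ltnW Nn)).
have h3 : nm ((F n.+1).[RtoC r * expi t] - (F n.+1).[expi t]) <= e / 2.
  apply: (le_trans (HL _ _ _ _)).
  - by rewrite nmM nm_RtoC nm_expi mulr1 ger0_norm// ltW.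
  - by rewrite nm_expi.
  - have -> : RtoC r * expi t - expi t = RtoC (r - 1) * expi t :> C.
      by rewrite RtoCB mulrBl; congr (_ - _); rewrite mul1r.
    rewrite nmM nm_RtoC nm_expi mulr1 ler0_norm ?subr_le0 ?(ltW r1)// opprB.
    apply: (@le_trans _ _ ((L + 1) * (e / 2 / (L + 1)))); last first.
      by rewrite mulrC divfK// gt_eqF.
    by rewrite ler_pM ?subr_ge0 ?(ltW r1)// ?lerDl//; lra.
have h4 := HM n Mn.
have := nm_triangle (F n.+1).[RtoC r * expi t] (f (RtoC r * expi t)) (Psi t).
have := nm_triangle (F n.+1).[expi t] (F n.+1).[RtoC r * expi t] (Psi t).
rewrite [nm (f _ - (F n.+1).[_])]nmB; move: h1 h2 h3 h4; lra.
Qed.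

End DiskFunction.

(** * Ambiguous points *)

Section AmbiguousPoints.
Variable R : realType.
Local Notation C := (Cplx R).
Local Notation mu := (@lebesgue_measure R).

Lemma negligible_bigcup_countable (T : countType) (F : T -> set R) :
  (forall x, mu.-negligible (F x)) -> mu.-negligible [set t | exists x, F x t].
Proof.
move=> nF.
pose G n : set R := if unpickle n is Some x then F x else set0.
apply: (@negligibleS _ _ _ mu (\bigcup_n G n)).
  by move=> t [x Fx]; exists (pickle x) => //; rewrite /G pickleK.
apply: negligible_bigcup => n; rewrite /G; case: unpickle => [x|]; first exact: nF.
exact: negligible_set0.
Qed.

Lemma negligible_subsingleton (A : set R) :
  (forall x y, A x -> A y -> x = y) -> mu.-negligible A.
Proof.
move=> HA; have [[x Ax]|nA] := pselect (exists x, A x).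
  apply: (@negligibleS _ _ _ mu [set x]); first by move=> y Ay; rewrite (HA y x).
  by exists [set x]; split => //; exact: lebesgue_measure_set1.
by apply: negligibleS (negligible_set0 mu) => x Ax; case: nA; exists x.
Qed.

(** A rational in the gap next to [t] determines [t]: of two points sharing it, one would lie in the
    gap of the other. Both sets are therefore countable. *)
Lemma negligible_isolated (E : set R) :
  mu.-negligible [set t | E t /\ (exists2 r, t < r & forall x, t < x -> x < r -> ~ E x)] /\
  mu.-negligible [set t | E t /\ (exists2 r, r < t & forall x, r < x -> x < t -> ~ E x)].
Proof.
split.
  apply: (@negligibleS _ _ _ mu [set t | exists q : rat,
    E t /\ (t < ratr q /\ forall x, t < x -> x < ratr q -> ~ E x)]).
    move=> t [Et [r tr Hr]]; have [q] := rat_in_itvoo tr.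
    rewrite in_itv/= => /andP[tq qr]; exists q; split => //; split => // x tx xq.
    by apply: Hr => //; exact: lt_trans qr.
  apply: negligible_bigcup_countable => q; apply: negligible_subsingleton.
  move=> x y [Ex [xq Hx]] [Ey [yq Hy]]; have [xy|yx|//] := ltrgtP x y.
    by have := Hx y xy yq.
  by have := Hy x yx xq.
apply: (@negligibleS _ _ _ mu [set t | exists q : rat,
  E t /\ (ratr q < t /\ forall x, ratr q < x -> x < t -> ~ E x)]).
  move=> t [Et [r tr Hr]]; have [q] := rat_in_itvoo tr.
  rewrite in_itv/= => /andP[tq qr]; exists q; split => //; split => // x tx xq.
  by apply: Hr => //; exact: lt_trans tx.
apply: negligible_bigcup_countable => q; apply: negligible_subsingleton.
move=> x y [Ex [xq Hx]] [Ey [yq Hy]]; have [xy|yx|//] := ltrgtP x y.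
  by have := Hy x xq xy.
by have := Hx y yq yx.
Qed.

Lemma expi_near0 (e : R) : 0 < e ->
  exists2 d : R, 0 < d & forall u, `|u| < d -> nm (expi u - 1) < e.
Proof.
move=> e0; have e20 : 0 < e / 2 by rewrite divr_gt0.
have /cvgrPdist_lt/(_ _ e20)/nbhs_normP[d1 /= d10 H1] := @continuous_cos R 0.
have /cvgrPdist_lt/(_ _ e20)/nbhs_normP[d2 /= d20 H2] := @continuous_sin R 0.
exists (Num.min d1 d2); first by rewrite lt_min d10.
move=> u; rewrite lt_min => /andP[u1 u2].
have h1 : `|cos u - 1| < e / 2.
  have := H1 u; rewrite /ball_ /= cos0 sub0r normrN distrC ; exact.
have h2 : `|sin u| < e / 2.
  have := H2 u; rewrite /ball_ /= sin0 !sub0r !normrN ; exact.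
apply: (le_lt_trans (nm_ReIm (expi u - 1))) => /=.
by rewrite oppr0 addr0 [ltRHS](Num.Theory.splitr e) ltrD.
Qed.

Lemma on_radius (z : C) (x : R) : complex.Im (z * expi (- x)) = 0 ->
  0 <= complex.Re (z * expi (- x)) -> z = RtoC (nm z) * expi x.
Proof.
move=> I0 R0; have nz : nm z = complex.Re (z * expi (- x)).
  apply/eqP; rewrite -(eqrXn2 (n:=2)) ?nm_ge0//.
  rewrite -[nm z]mulr1 -(nm_expi (- x)) -nmM nm_sqr I0.
  by rewrite expr0n/= addr0.
have zE : RtoC (nm z) = z * expi (- x).
  by rewrite nz; move: I0; case: (z * _) => a b /= ->.
by rewrite zE -mulrA [expi (- x) * _]mulrC expiN mulr1.
Qed.

Lemma within_nm (A : set C) (w : C -> C) (z : C) : {within A, continuous w} -> A z ->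
  forall e : R, 0 < e -> exists2 d : R, 0 < d &
    forall y, A y -> nm (y - z) < d -> nm (w y - w z) < e.
Proof.
move=> /subspace_continuousP/(_ z) + Az e e0 => /(_ Az)/cvg_nm/(_ e e0).
by move=> /nbhs_nm[d d0 H]; exists d => // y Ay /H; exact.
Qed.

Lemma near_left (P : R -> Prop) (x : R) : (\forall t \near x^'-, P t) ->
  exists2 t0, t0 < x & forall t, t0 < t -> t < x -> P t.
Proof.
move=> /nbhs_normP[d /= d0 H]; exists (x - d); first by rewrite ltrBlDr ltrDl.
by move=> t xt tx; apply: H => //=; rewrite gtr0_norm ?subr_gt0//; lra.
Qed.

(** Intermediate value theorem for the signed distance from [g t] to the line carrying the radius of
    angle [x]. Which half of the line is met is settled later by the sign of the real part. *)
Lemma radius_crossing (g : R -> C) (t1 t2 x : R) : 0 <= t1 -> t1 <= t2 -> t2 < 1 ->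
  {within `[0, 1[, continuous g} ->
  complex.Im (g t1 * expi (- x)) * complex.Im (g t2 * expi (- x)) <= 0 ->
  exists2 t, t1 <= t <= t2 & complex.Im (g t * expi (- x)) = 0.
Proof.
move=> t10 t12 t21 cg sgn.
pose b t : R := complex.Im (g t * expi (- x)).
have cb : {within `[t1, t2], continuous b}.
  have sub : (`[t1, t2]%classic : set R) `<=` `[0, 1[%classic.
    move=> t /=; rewrite !in_itv/= => /andP[h1 h2].
    by rewrite (le_trans t10)//= (le_lt_trans h2).
  have {}cg := continuous_subspaceW sub cg.
  apply/subspace_continuousP => t tt.
  move/subspace_continuousP/(_ t tt)/cvg_nm: cg => cg.
  apply/cvgrPdist_lt => e e0; apply: filterS (cg e e0) => s h.
  rewrite /b distrC; apply: le_lt_trans h.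
  have -> : complex.Im (g s * expi (- x)) - complex.Im (g t * expi (- x)) =
      complex.Im ((g s - g t) * expi (- x)).
    by case: (g s) (g t) => ? ? [? ?] /=; ring.
  by rewrite (le_trans (Im_nm _))// nmM nm_expi mulr1.
have [|t] := IVT (v := 0) t12 cb.
  rewrite -/(b t1) -/(b t2) in sgn.
  rewrite ge_min le_max; have [h1|h1] := lerP (b t1) 0; have [h2|h2] := lerP (b t2) 0 => //=.
  - have [->|b1] := eqVneq (b t1) 0; first by rewrite lexx.
    have : 0 <= b t2.
      by rewrite -(nmulr_rle0 _ (_ : b t1 < 0)) ?lt_neqAle ?b1.
    by move=> ->; rewrite orbT.
  - by rewrite (ltW h2) orbT.
  - by rewrite (ltW h1).
  - by move: sgn; rewrite leNgt mulr_gt0.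
by rewrite in_itv/= => tt bt; exists t.
Qed.

End AmbiguousPoints.

Section Ambiguous.
Variable R : realType.
Local Notation C := (Cplx R).
Local Notation mu := (@lebesgue_measure R).

(** Angles whose radius has its final piece sent into one disk with rational centre. The codes [k]
    are countably many, so a null set may be discarded for each. *)
Definition radius_in (f : C -> C) (k : (rat * rat) * (nat * nat)) : set R :=
  [set t | circ t /\ forall r : R, 1 - k.2.1.+1%:R^-1 <= r < 1 ->
     nm (f (RtoC r * expi t) - Complex (ratr k.1.1) (ratr k.1.2)) < k.2.2.+1%:R^-1].

(* An arc ending at [expi th] that misses the preimage of the rational disk coded by [k]
   also misses the radii ending at the points of [radius_in f k], so it lies strictly on
   one side of the radius of [th]; but such radii accumulate on that side. *)
Lemma radius_crossed (f : C -> C) (g : R -> C) k (t0 th : R) :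
  (forall t, 0 <= t < 1 -> nm (g t) < 1) -> {within `[0, 1[, continuous g} ->
  g t @[t --> 1^'-] --> (expi th : C) -> t0 < 1 -> radius_in f k th ->
  (forall r, th < r -> exists x, [/\ th < x, x < r & radius_in f k x]) ->
  (forall r, r < th -> exists x, [/\ r < x, x < th & radius_in f k x]) ->
  exists2 t, t0 < t < 1 & 0 <= t /\
    nm (f (g t) - Complex (ratr k.1.1) (ratr k.1.2)) < k.2.2.+1%:R^-1.
Proof.
move=> g1 cg gth t01 Eth accR accL.
apply: contrapT => Hno.
have noE x t : radius_in f k x -> t0 < t < 1 -> 0 <= t ->
    1 - k.2.1.+1%:R^-1 <= nm (g t) -> complex.Im (g t * expi (- x)) = 0 ->
    0 <= complex.Re (g t * expi (- x)) -> False.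
  move=> [_ Ex] t01' t_0 gk I0 R0; apply: Hno; exists t => //; split => //.
  rewrite (on_radius I0 R0) ; apply: Ex; rewrite gk/=.
  by apply: g1; case/andP: t01' => _ ->; rewrite t_0.
(* The bound 1/4 rules out the opposite half of a crossed line; the other bound keeps the arc in the
   annulus where [radius_in] gives information. *)
pose d : R := Num.min 4^-1 k.2.1.+1%:R^-1.
have d0 : 0 < d by rewrite /d lt_min !invr_gt0 !ltr0n.
have d4 : d <= 4^-1 by rewrite /d ge_min lexx.
have dk : d <= k.2.1.+1%:R^-1 by rewrite /d ge_min lexx orbT.
have [t' t'1 Ht'] := near_left ((cvg_nm _ _ _).1 gth d d0).
pose t1 := Num.max (1 / 2) (Num.max ((t0 + 1) / 2) ((t' + 1) / 2)).
have t1h : 1 / 2 <= t1 by rewrite /t1 le_max lexx.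
have t10 : t0 < t1.
  rewrite /t1 !lt_max; apply/orP; right; apply/orP; left; lra.
have t1t' : t' < t1.
  rewrite /t1 !lt_max; apply/orP; right; apply/orP; right; lra.
have t11 : t1 < 1 by rewrite /t1 !gt_max; apply/and3P; split; lra.
have close t : t1 <= t -> t < 1 -> nm (g t - expi th) < d.
  by move=> tt tt1; apply: Ht' => //; exact: lt_le_trans tt.
have big t : t1 <= t -> t < 1 -> 1 - k.2.1.+1%:R^-1 <= nm (g t).
  move=> tt tt1; have h := close t tt tt1.
  have := nmD (expi th - g t) (g t); rewrite subrK nm_expi nmB => h1.
  by rewrite lerBlDl (le_trans h1)// lerD2r (le_trans (ltW h)).
have ReB (x y : C) : complex.Re (x - y) = complex.Re x - complex.Re y by case: x y => ? ? [].
have expiB (x : R) : nm (expi th - expi x : C) = nm (expi (x - th) - 1 : C).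
  have -> : expi x = expi (x - th) * expi th :> C by rewrite -expiD subrK.
  by rewrite nmB -{2}[expi th]mul1r -mulrBl nmM nm_expi mulr1.
have Re_pos x t : t1 <= t -> t < 1 -> nm (expi (x - th) - 1 : C) < 4^-1 ->
    0 <= complex.Re (g t * expi (- x)).
  move=> tt tt1 xth; have h := close t tt tt1.
  have h1 : nm (g t * expi (- x) - 1) < 4^-1 + 4^-1.
    rewrite -(expiN x) -mulrBl nmM nm_expi mulr1.
    rewrite (le_lt_trans (nm_triangle (expi th) _ _))// ltrD ?expiB//.
    exact: lt_le_trans d4.
  have := le_lt_trans (Re_nm _) h1; rewrite ReB /= ltr_norml => /andP[h2 _].
  by move: h2; lra.
have t1_0 : 0 <= t1 by apply: le_trans t1h; rewrite divr_ge0.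
have I1 : complex.Im (g t1 * expi (- th)) != 0.
  apply/eqP => I0; apply: (noE th t1 Eth) => //; first by rewrite t10.
  - exact: big.
  - by apply: Re_pos => //; rewrite subrr expi0 subrr nm0 invr_gt0.
have crossing x : radius_in f k x -> nm (expi (x - th) - 1 : C) < 4^-1 ->
  (exists2 t2, t1 <= t2 < 1 &
     complex.Im (g t1 * expi (- x)) * complex.Im (g t2 * expi (- x)) <= 0) -> False.
  move=> Ex xth [t2 /andP[t12 t21] sgn].
  have [t /andP[tt tt2] It] := radius_crossing t1_0 t12 t21 cg sgn.
  have t_1 : t < 1 by apply: le_lt_trans t21.
  apply: (noE x t Ex) => //.
  - by rewrite t_1 andbT (lt_le_trans t10).
  - exact: le_trans tt.
  - exact: big.
  - exact: Re_pos.
pose I := complex.Im (g t1 * expi (- th)).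
have aI : 0 < `|I| by rewrite normr_gt0.
have ImB (x y : C) : complex.Im (x - y) = complex.Im x - complex.Im y by case: x y => ? ? [].
(* Near its end the arc is close to [expi th], so its signed distance to the line of angle [x] takes
   the sign of [sin (th - x)]. *)
have tail x : sin (th - x) != 0 -> exists2 t2, t1 <= t2 < 1 &
    `|complex.Im (g t2 * expi (- x)) - sin (th - x)| < `|sin (th - x)|.
  move=> s0; have as0 : 0 < `|sin (th - x)| by rewrite normr_gt0.
  have [t2 t21 H2] := near_left ((cvg_nm _ _ _).1 gth _ as0).
  pose t3 := Num.max t1 ((t2 + 1) / 2).
  have t31 : t3 < 1 by rewrite /t3 gt_max t11/=; lra.
  have t23 : t2 < t3 by rewrite /t3 lt_max; apply/orP; right; lra.
  exists t3; first by rewrite t31 andbT /t3 le_max lexx.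
  apply: le_lt_trans (H2 _ t23 t31).
  have -> : sin (th - x) = complex.Im (expi th * expi (- x) : C) by rewrite -expiD.
  by rewrite -ImB -mulrBl (le_trans (Im_nm _))// nmM nm_expi mulr1.
have m0 : 0 < Num.min 4^-1 `|I| by rewrite lt_min invr_gt0 ltr0n aI.
have [d1 d10 Hd1] := @expi_near0 R _ m0.
pose u := Num.min d1 1.
have u0 : 0 < u by rewrite /u lt_min d10 ltr01.
have ud : u <= d1 by rewrite /u ge_min lexx.
have u1 : u <= 1 by rewrite /u ge_min lexx orbT.
have pi2 := pi_ge2 R.
have Ix x : `|x - th| < u ->
    nm (expi (x - th) - 1 : C) < 4^-1 /\
    `|complex.Im (g t1 * expi (- x)) - I| < `|I|.
  move=> xu.
  have := Hd1 (x - th) (lt_le_trans xu ud); rewrite lt_min => /andP[h1 h2].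
  split => //; apply: le_lt_trans h2; rewrite /I -ImB -mulrBr (le_trans (Im_nm _))//.
  rewrite nmM -[leRHS]mul1r ler_pM ?nm_ge0//.
    by rewrite ltW// g1// t1_0.
  have -> : expi (- x) - expi (- th) = expi (- x) * (1 - expi (x - th)) :> C.
    by rewrite mulrBr mulr1 -expiD addKr.
  by rewrite nmM nm_expi mul1r nmB.
have sgn_close (a b : R) : `|a - b| < `|b| -> (b < 0 -> a < 0) /\ (0 < b -> 0 < a).
  move=> ab; split=> b0.
    by move: ab; rewrite [ltRHS]ltr0_norm// ltr_norml => /andP[_]; lra.
  by move: ab; rewrite [ltRHS]gtr0_norm// ltr_norml => /andP[+ _]; lra.
have finish x : radius_in f k x -> `|x - th| < u -> I * sin (th - x) < 0 -> False.
  move=> Ex xu Is; have [x4 xI] := Ix x xu; apply: (crossing x Ex x4).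
  have s0 : sin (th - x) != 0 by apply/eqP => s0; move: Is; rewrite s0 mulr0 ltxx.
  have [t2 t12 H2] := tail x s0; exists t2 => //; apply: ltW.
  have [I_neg I_pos] := sgn_close _ _ xI; have [s_neg s_pos] := sgn_close _ _ H2.
  have [I0|I0|I0] := ltrgtP 0 I; last by rewrite -I0 mul0r ltxx in Is.
    by move: Is; rewrite (pmulr_rlt0 _ I0) (pmulr_rlt0 _ (I_pos I0)) => /s_neg.
  by move: Is; rewrite (nmulr_rlt0 _ I0) (nmulr_rlt0 _ (I_neg I0)) => /s_pos.
(* The sign of [I] tells on which side of the radius of [th] the point [g t1] lies; a good radius on
   that side, closer to [th], separates it from the end of the arc. *)
have [I0|I0|I0] := ltrgtP 0 I; last by move: I1; rewrite -/I -I0 eqxx.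
- have [|x [thx xu Ex]] := accR (th + u); first by rewrite ltrDl.
  apply: (finish x Ex); first by rewrite gtr0_norm ?subr_gt0//; lra.
  rewrite pmulr_rlt0// -opprB sinN oppr_lt0 sin_gt0_pi// subr_gt0 thx/=; lra.
- have [|x [thx xu Ex]] := accL (th - u); first by rewrite gtrDl oppr_lt0.
  apply: (finish x Ex); first by rewrite ltr0_norm ?subr_lt0//; lra.
  rewrite nmulr_rlt0// sin_gt0_pi// subr_gt0 xu/=; lra.
Qed.

(* Bagemihl's ambiguous point theorem, in the presence of radial limits.  Only countably
   many points of each set [radius_in f k] fail to be limits from both sides. *)
Lemma ambiguous_points (f : C -> C) : exists2 B : set R, mu.-negligible B &
  forall (th : R) (c : C) (g : R -> C), circ th -> ~ B th ->
  (forall e : R, 0 < e -> exists2 r0 : R, r0 < 1 &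
     forall r, r0 <= r < 1 -> 0 <= r -> nm (f (RtoC r * expi th) - c) <= e) ->
  (forall t, 0 <= t < 1 -> nm (g t) < 1) -> {within `[0, 1[, continuous g} ->
  g t @[t --> 1^'-] --> (expi th : C) ->
  forall t0 e : R, t0 < 1 -> 0 < e ->
  exists2 t, t0 < t < 1 & 0 <= t /\ nm (f (g t) - c) < e.
Proof.
pose BR k := [set t : R | radius_in f k t /\
  exists2 r, t < r & forall x, t < x -> x < r -> ~ radius_in f k x].
pose BL k := [set t : R | radius_in f k t /\
  exists2 r, r < t & forall x, r < x -> x < t -> ~ radius_in f k x].
exists ([set t | exists k, BR k t] `|` [set t | exists k, BL k t]).
  by apply: negligibleU; apply: negligible_bigcup_countable => k;
    have [] := negligible_isolated (radius_in f k).
move=> th c g cth /not_orP[nR nL] rad g1 cg gth t0 e t01 e0.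
(* The rational disk will have radius [dm < e / 2] and centre within [dm / 2] of [c], so its points
   are within [3 / 2 * dm < e] of [c]. *)
have [m Hm] : exists m : nat, m.+1%:R^-1 < e / 2.
  have e2 : 0 < e / 2 by rewrite divr_gt0.
  exists (Num.bound (e / 2)^-1); rewrite invf_plt ?posrE//.
  rewrite (lt_trans (archi_boundP _))// ?invr_ge0 ?ltW// ltr_nat//.
have m0 : 0 < m.+1%:R^-1 :> R by rewrite invr_gt0 ltr0n.
set dm : R := m.+1%:R^-1 in Hm m0.
have [a [b ab]] : exists a b : rat, nm (c - Complex (ratr a) (ratr b)) < dm / 2.
  have [a] := @rat_in_itvoo R (complex.Re c) (complex.Re c + dm / 4) ltac:(lra).
  have [b] := @rat_in_itvoo R (complex.Im c) (complex.Im c + dm / 4) ltac:(lra).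
  rewrite !in_itv/= => /andP[b1 b2] /andP[a1 a2]; exists a, b.
  rewrite (le_lt_trans (nm_ReIm _))//.
  have -> : c - Complex (ratr a) (ratr b) =
     Complex (complex.Re c - ratr a) (complex.Im c - ratr b) by case: (c).
  by rewrite /= !ltr0_norm ?subr_lt0//; lra.
have [r0 r01 Hr0] := rad (dm / 4) ltac:(by rewrite divr_gt0).
have [k Hk] : exists k : nat, k.+1%:R^-1 < 1 - r0.
  have e2 : 0 < 1 - r0 by rewrite subr_gt0.
  exists (Num.bound (1 - r0)^-1); rewrite invf_plt ?posrE//.
  rewrite (lt_trans (archi_boundP _))// ?invr_ge0 ?ltW// ltr_nat//.
pose K := ((a, b), (k, m)).
have ETh : radius_in f K th.
  split => // r /andP[/= r1 r2].
  have k1 : k.+1%:R^-1 <= 1 :> R by rewrite invf_le1 ?ltr0n// ler1n.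
  have rr : 0 <= r by rewrite (le_trans _ r1)// subr_ge0.
  have := Hr0 r; rewrite r2 andbT => /(_ _ rr) h.
  rewrite (le_lt_trans (nm_triangle c _ _))//.
  have {}h : nm (f (RtoC r * expi th) - c) <= dm / 4.
    by apply: h; move: Hk r1; set q := _^-1; lra.
  by rewrite -/dm; lra.
have acR r : th < r -> exists x, [/\ th < x, x < r & radius_in f K x].
  move=> thr; apply: contrapT => H; apply: nR; exists K; split => //.
  by exists r => // x tx xr Ex; apply: H; exists x.
have acL r : r < th -> exists x, [/\ r < x, x < th & radius_in f K x].
  move=> thr; apply: contrapT => H; apply: nL; exists K; split => //.
  by exists r => // x tx xr Ex; apply: H; exists x.
have [t tt [t_0 Ht]] := radius_crossed g1 cg gth t01 ETh acR acL.
exists t => //; split => //.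
rewrite (le_lt_trans (nm_triangle (Complex (ratr a) (ratr b)) _ _))//.
rewrite [nm (_ - c)]nmB; move: Ht ab => /=; rewrite -/dm; lra.
Qed.

End Ambiguous.

(** * Transport to the unit disk *)

Section BoundaryTransport.
Variable R : realType.
Local Notation C := (Cplx R).

Lemma expi_surj (z : C) : nm z = 1 -> exists2 t, circ t & z = expi t.
Proof.
move=> z1; have := nm_sqr z; rewrite z1 expr1n => xy.
set x := complex.Re z in xy; set y := complex.Im z in xy.
have x1 : -1 <= x <= 1.
  by rewrite -ler_norml (le_trans (Re_nm z))// z1.
have sq : Num.sqrt (1 - x ^+ 2) = `|y|.
  by rewrite -sqrtr_sqr; congr Num.sqrt; rewrite xy addrC addKr.
have p0 := pi_gt0 R.
have a0 := acos_ge0 x1; have a1 := acos_lepi x1.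
have zE a b : a = x -> b = y -> z = Complex a b.
  by move=> -> ->; rewrite /x /y; case: z {z1 xy x1 sq a0 a1 x y}.
have [y0|y0] := lerP 0 y.
  exists (acos x); first by apply/andP; split => //; lra.
  by apply: zE; rewrite ?acosK ?in_itv//= sin_acos// sq ger0_norm.
exists (2 * pi - acos x).
  have a00 : 0 < acos x.
    rewrite lt_neqAle a0 andbT; apply/eqP => a00.
    have := sin_acos x1; rewrite -a00 sin0 sq => /esym/eqP.
    by rewrite normr_eq0 => /eqP y00; rewrite y00 ltxx in y0.
  by apply/andP; split; lra.
apply: zE; first by rewrite cos_2piB acosK ?in_itv.
have -> : 2 * pi - acos x = - acos x + pi *+ 2 by rewrite mulr_natl addrC.
by rewrite sinD2pi sinN sin_acos// sq ltr0_norm// opprK.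
Qed.

Lemma expi_neq (s t : R) : circ s -> circ t -> s < t -> expi s <> expi t :> C.
Proof.
move=> /andP[s0 s2] /andP[t0 t2] st; have p0 := pi_gt0 R.
move=> /(congr1 (fun z => complex.Re (z * expi (- s)))).
rewrite expiN -expiD /= => ct; have : cos (t - s) < cos 0 :> R.
  have [h|h] := lerP (t - s) pi; first by apply: cos_lt; lra.
  by rewrite -(cos_2piB (t - s)); apply: cos_lt; lra.
by rewrite -ct cos0 ltxx.
Qed.

Lemma expi_inj (s t : R) : circ s -> circ t -> expi s = expi t :> C -> s = t.
Proof.
move=> cs ct; have [st|ts|//] := ltrgtP s t => st'; exfalso.
  by apply: (expi_neq cs ct st).
by apply: (expi_neq ct cs ts).
Qed.

Lemma open_diskP (z : C) : @open_disk R z <-> nm z < 1.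
Proof. by rewrite /open_disk /= -[1]/(RtoC 1) nm_ltP. Qed.

Lemma closed_diskP (z : C) : @closed_disk R z <-> nm z <= 1.
Proof. by rewrite /closed_disk /= -[1]/(RtoC 1) nm_leP. Qed.

(** [D] fills the open disk, so by injectivity on the closure no other point of the closure is sent
    there; and [D] being open, those other points form [bdry D]. *)
Lemma conformal_bdry (D : set C) (w : C -> C) : open D -> conformal_ext D w ->
  forall z, bdry D z <-> closure D z /\ nm (w z) = 1.
Proof.
move=> oD [_ [winj [wD [wcD _]]]] z; rewrite /bdry.
have iD : interior D = D by apply/interior_id.
have DcD : D `<=` closure D := @subset_closure _ D.
have cd y : closure D y -> nm (w y) <= 1.
  by move=> cy; apply/closed_diskP; rewrite -wcD; exists y.
rewrite iD; split=> [[cz nDz]|[cz wz1]].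
  split => //; apply/eqP; rewrite eq_le cd//= leNgt; apply/negP => /open_diskP.
  by rewrite -wD => -[y Dy wy]; apply: nDz; rewrite -(winj y z (DcD y Dy) cz wy).
split => // Dz; have /open_diskP : @open_disk R (w z) by rewrite -wD; exists z.
by rewrite wz1 ltxx.
Qed.

Lemma Re_conjM_le (l a b : C) : nm l = 1 ->
  nm (RtoC (complex.Re (conjc l * a)) - RtoC (complex.Re (conjc l * b))) <= nm (a - b).
Proof.
move=> l1; rewrite -RtoCB nm_RtoC.
have -> : complex.Re (conjc l * a) - complex.Re (conjc l * b) =
    complex.Re (conjc l * (a - b)).
  by case: l a b {l1} => ? ? [? ?] [? ?] /=; ring.
rewrite (le_trans (Re_nm _))// nmM.
suff -> : nm (conjc l) = 1 by rewrite mul1r.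
by rewrite -l1; case: l {l1} => x y; rewrite /nm /= sqrrN.
Qed.

Lemma Re_conjMK (l : C) (x : R) : nm l = 1 -> complex.Re (conjc l * (l * RtoC x)) = x.
Proof.
move=> l1; have := nm_sqr l; rewrite l1 expr1n.
case: l {l1} => a b /= h; rewrite -[RHS]mul1r h; ring.
Qed.

Lemma derivable_continuous (w : C -> C) (z : C) :
  derivable w z 1 -> {for z, continuous w}.
Proof. by move=> /derivable1_diffP/differentiable_continuous. Qed.

End BoundaryTransport.

Theorem theorem4p1 (R : realType) (D : set (Cplx R)) (w : Cplx R -> Cplx R)
    (lam : Cplx R -> Cplx R) (phi : Cplx R -> R) :
  jordan_domain D -> conformal_ext D w ->
  (forall zeta, bdry D zeta -> `|lam zeta| = 1) ->
  harm_measurable_cfun D w lam -> harm_measurable_rfun D w phi ->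
  exists f : Cplx R -> Cplx R, holomorphic_on D f /\
    exists N : set (Cplx R), harm_null D w N /\
      forall zeta, bdry D zeta -> ~ N zeta ->
        principal_asymptotic_values D
          (fun z => RtoC (@complex.Re R (conjc (lam zeta) * f z))) zeta
        = [set Some (RtoC (phi zeta))].
Proof.
move=> [oD [_ [_ [_ _]]]] wext lam1 [mRe mIm] mphi.
have wb := conformal_bdry oD wext.
have [whol [winj [wD [wcD [wcont [v [vw vcont]]]]]]] := wext.
have DcD : D `<=` closure D := @subset_closure _ D.
have wDlt z : D z -> nm (w z) < 1.
  by move=> Dz; apply/open_diskP; rewrite -wD; exists z.
have vE (z : Cplx R) : nm z <= 1 -> closure D (v z) /\ w (v z) = z.
  by move=> /closed_diskP; rewrite -wcD => -[y cy <-]; rewrite vw.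
have vD (z : Cplx R) : nm z < 1 -> D (v z).
  by move=> /open_diskP; rewrite -wD => -[y Dy <-]; rewrite vw//; exact: DcD.
have vexp t : bdry D (v (expi t)) /\ w (v (expi t)) = expi t.
  have [cv wv] := vE (expi t) (eq_ind_r (fun x => x <= 1) (lexx 1) (nm_expi t)).
  by split => //; apply/wb; rewrite wv nm_expi.
(* In the angle coordinate, harmonic measurability of [psi] becomes Lebesgue measurability of its
   composition with [v] on the circle. *)
have theta psi (B : set R) :
    theta_set D w (psi @^-1` B) = @circ R `&` (fun t => psi (v (expi t))) @^-1` B.
  apply/seteqP; split => [t [ct [z [Bz bz] wz]]|t [ct Bt]]; split => //.
    by rewrite /= -wz vw//; case/wb: bz.
  by exists (v (expi t)); [split => //; exact: (vexp t).1|exact: (vexp t).2].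
have approx psi : harm_measurable_rfun D w psi ->
    circle_approx (fun t => RtoC (psi (v (expi t)))).
  move=> mpsi; apply: (@circle_approx_rfun _ (fun t => psi (v (expi t)))) => B mB.
  by rewrite -theta; exact: mpsi.
have lam_nm z : bdry D z -> nm (lam z) = 1.
  by move=> /lam1; rewrite normE => -[].
pose Psi t := lam (v (expi t)) * RtoC (phi (v (expi t))).
have HPsi : circle_approx Psi.
  apply: circle_approxM; last exact: approx.
  have H := circle_approxD (approx _ mRe)
    (circle_approxM (circle_approx_cst (Complex 0 1)) (approx _ mIm)).
  apply: circle_approx_ext H => t _; case: (lam _) => a b.
  by apply/eqP; rewrite eq_complex /= !mul0r !mulr0 mul1r !subr0 !addr0 !add0r !eqxx.
have [f0 [f0hol [Z nZ radial]]] := disk_function HPsi.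
have [B nB amb] := ambiguous_points f0.
exists (fun z => f0 (w z)); split.
  move=> z Dz; apply/derivable1_diffP.
  apply: (@differentiable_comp _ _ _ _ w f0); apply/derivable1_diffP.
    exact: whol.
  exact/f0hol/wDlt.
exists [set z | exists2 t, circ t & w z = expi t /\ (Z t \/ B t)]; split.
  apply: negligibleS (negligibleU nZ nB) => t [ct [z [[s cs [ws ZB]] bz] wz]].
  suff -> : t = s by case: ZB; [left|right].
  apply: expi_inj ct cs _; by rewrite -wz.
move=> zeta bz nN.
have [cz wz1] := (wb zeta).1 bz.
have [th cth wth] := expi_surj wz1.
have nZ' : ~ Z th by move=> h; apply: nN; exists th => //; split => //; left.
have nB' : ~ B th by move=> h; apply: nN; exists th => //; split => //; right.
have vth : v (expi th) = zeta by rewrite -wth vw.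
have PsiE : Psi th = lam zeta * RtoC (phi zeta) by rewrite /Psi vth.
have rad := radial th cth nZ'.
have l1 := lam_nm _ bz.
pose Om z : Cplx R := RtoC (complex.Re (conjc (lam zeta) * f0 (w z))).
have OmE z : nm (Om z - RtoC (phi zeta)) <= nm (f0 (w z) - Psi th).
  rewrite -[phi zeta](Re_conjMK _ l1) -PsiE; exact: Re_conjM_le.
apply/seteqP; split => [val Po|_ ->].
  (* The preimage of the radius ending at [w zeta]; continuity of [v] up to the circle makes it an
     arc terminating at [zeta]. *)
  pose g (t : R) := v (RtoC t * w zeta).
  have gnm (t : R) : 0 <= t -> nm (RtoC t * w zeta) = t.
    by move=> t0; rewrite nmM nm_RtoC wz1 mulr1 ger0_norm.
  have gw t : 0 <= t < 1 -> w (g t) = RtoC t * w zeta.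
    by move=> /andP[t0 t1]; apply: (vE _ _).2; rewrite gnm// ltW.
  have gD t : 0 <= t < 1 -> D (g t).
    by move=> /andP[t0 t1]; apply: vD; rewrite gnm.
  have dist (s t : R) : nm (RtoC s * w zeta - RtoC t * w zeta) = `|s - t|.
    by rewrite -mulrBl -RtoCB nmM nm_RtoC wz1 mulr1.
  have g1 : g 1 = zeta by rewrite /g -[RtoC 1]/(1 : Cplx R) mul1r vw.
  have gcont (s : R) : 0 <= s <= 1 -> forall e : R, 0 < e -> exists2 d : R, 0 < d &
      forall t : R, 0 <= t <= 1 -> `|t - s| < d -> nm (g t - g s) < e.
    move=> /andP[s0 s1] e e0.
    have cs : @closed_disk R (RtoC s * w zeta) by apply/closed_diskP; rewrite gnm.
    have [d d0 Hd] := within_nm vcont cs e0; exists d => // t /andP[t0 t1] ts.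
    by apply: Hd; [apply/closed_diskP; rewrite gnm|rewrite dist].
  have arc : arc_to D zeta g.
    split; first exact: gD.
    split; last split.
    - apply/subspace_continuousP => s; rewrite /= in_itv/= => /andP[s0 s1].
      apply/cvg_nm => e e0; have [|d d0 Hd] := gcont s _ e e0; first by rewrite s0 ltW.
      apply/nbhs_normP; exists d => //= t ts; rewrite in_itv/= => /andP[t0 t1].
      by apply: Hd; [rewrite t0 ltW|rewrite distrC].
    - move=> s t hs ht gst; have := congr1 w gst; rewrite !gw//.
      move/(congr1 (fun z => nm (z - RtoC t * w zeta))); rewrite !dist subrr normr0.
      by move/normr0_eq0/subr0_eq.
    - apply/cvg_nm => e e0; have [|d d0 Hd] := gcont 1 _ e e0; first by rewrite ler01 lexx.
      apply/nbhs_normP; exists (Num.min d 1); rewrite /= ?lt_min ?d0 ?ltr01//.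
      move=> t /=; rewrite lt_min => /andP[t1d t11] t1; rewrite -g1; apply: Hd.
        rewrite (ltW t1) andbT; move: t11; rewrite gtr0_norm ?subr_gt0//; lra.
      by rewrite distrC.
  have [u [u01 [ugz ulim]]] := Po g arc.
  (* Continuity of [w] at [zeta] forces the parameters [u n] to 1, where the radial limit
     applies. *)
  have Omlim (e : R) : 0 < e -> \forall n \near \oo, nm (Om (g (u n)) - RtoC (phi zeta)) <= e.
    move=> e0; have [r0 r01 Hr] := rad e e0.
    have r00 : 0 < 1 - r0 by rewrite subr_gt0.
    have [d d0 Hd] := within_nm wcont cz r00.
    move/cvg_nm: ugz => /(_ d d0); apply: filterS => n gd.
    have un := u01 n; have /andP[un0 un1] := un.
    have := Hd (g (u n)) (DcD _ (gD _ un)) gd; rewrite gw// => h.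
    apply: (le_trans (OmE _)); rewrite gw// wth; apply: Hr => //.
    rewrite un1 andbT; move: h; rewrite -[X in _ - X]mul1r -[1 in X in nm X]/(RtoC 1) dist.
    rewrite ltr0_norm ?subr_lt0//; lra.
  case: val Po ulim => [c|] Po ulim.
    congr Some; apply/eqP; rewrite -subr_eq0 -nm_eq0 eq_le nm_ge0 andbT.
    apply/ler_addgt0Pr => e e0; rewrite add0r.
    have e20 : 0 < e / 2 by rewrite divr_gt0.
    have [n _ Hn] := filterI (Omlim _ e20) ((cvg_nm _ _ _).1 ulim _ e20).
    have [h1 h2] := Hn n (leqnn n).
    rewrite (le_trans (nm_triangle (Om (g (u n))) _ _))// [leRHS](Num.Theory.splitr e).
    by rewrite lerD// nmB ltW.
  (* Infinity is excluded because [Om] is eventually within 1 of [phi zeta]. *)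
  have [n _ Hn] := filterI (Omlim 1 ltr01) (ulim (1 + nm (RtoC (phi zeta)))).
  have [h1 h2] := Hn n (leqnn n); exfalso.
  move: h2; rewrite normE ltcR ltNge => /negP; apply.
  by rewrite -[X in nm X](subrK (RtoC (phi zeta))) (le_trans (nmD _ _))// lerD2r.
(* Conversely, [w] carries an arbitrary arc into the disk with end [expi th], where
   [ambiguous_points] applies. *)
move=> g [gD [gcont [ginj glim]]].
have wcontD z : D z -> {for z, continuous w}.
  by move=> /whol; exact: derivable_continuous.
have wg1 t : 0 <= t < 1 -> nm (w (g t)) < 1 by move=> /gD/wDlt.
have wgcont : {within `[0, 1[, continuous (w \o g)}.
  apply/subspace_continuousP => s s01.
  move/subspace_continuousP/(_ s s01): gcont => gs.
  by apply: (cvg_comp _ _ gs); apply: wcontD; apply: gD; move: s01; rewrite /= in_itv.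
have wglim : (w \o g) t @[t --> 1^'-] --> (expi th : Cplx R).
  apply/cvg_nm => e e0; rewrite -wth.
  have [d d0 Hd] := within_nm wcont cz e0.
  have [t0 t01 Ht0] := near_left ((cvg_nm _ _ _).1 glim d d0).
  apply/nbhs_normP; exists (Num.min (1 - t0) 1); rewrite /= ?lt_min ?subr_gt0 ?t01 ?ltr01//.
  move=> t /=; rewrite lt_min => /andP[h1 h2] t1.
  move: h1 h2; rewrite gtr0_norm ?subr_gt0// => h1 h2.
  by apply: Hd; [apply: DcD; apply: gD; rewrite t1 andbT; lra|apply: Ht0 => //; lra].
have key := amb th (Psi th) (w \o g) cth nB' rad wg1 wgcont wglim.
(* Parameters tending to 1 along which [f0] approaches its radial limit: the sequence that
   [cluster_set] asks for. *)
have /boolp.choice[u Hu] : forall n : nat, exists t, 1 - n.+1%:R^-1 < t < 1 /\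
    (0 <= t /\ nm (f0 (w (g t)) - Psi th) < n.+1%:R^-1).
  move=> n; have n0 : 0 < n.+1%:R^-1 :> R by rewrite invr_gt0 ltr0n.
  have [|t t1 t2] := key (1 - n.+1%:R^-1) _ _ n0; first by rewrite ltrBlDr ltrDl.
  by exists t.
have inv_small (e : R) : 0 < e -> \forall n \near \oo, n.+1%:R^-1 < e.
  move=> e0; exists (Num.bound e^-1) => // n /= bn.
  rewrite invf_plt ?posrE// (lt_le_trans (archi_boundP _)) ?invr_ge0 ?(ltW e0)//.
  by rewrite ler_nat leqW.
exists u; split; first by move=> n; have [/andP[_ h1] [h2 _]] := Hu n; rewrite h1 h2.
split.
  apply/cvg_nm => e e0.
  have [t0 t01 Ht0] := near_left ((cvg_nm _ _ _).1 glim e e0).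
  have t00 : 0 < 1 - t0 by rewrite subr_gt0.
  apply: filterS (inv_small _ t00) => n h; have [/andP[h1 h2] _] := Hu n.
  by apply: Ht0 => //; apply: lt_trans h1; rewrite ltrBrDl -ltrBrDr.
apply/cvg_nm => e e0; apply: filterS (inv_small e e0) => n h.
by have [_ [_ h1]] := Hu n; rewrite (le_lt_trans (OmE _))// (lt_trans h1).
Qed.
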